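(* Assume (A). There exists a function $f_\epsilon(t)=o_t(1)$ (depending on the constant $\epsilon$ in (A)) such that, whenever $d\ge (np)^{1+f_\epsilon(np)}$, no polynomial of degree at most $D=(\log n)^{5/4}/(\log\log n)$ in the edge indicators distinguishes $\mathsf{G}(n,p)$ from $\mathsf{RGG}(n,\mathbb{T}^d,\mathsf{Unif},\sigma^\infty_p,p)$; i.e., for every such polynomial $f$, $$\big|\mathbf{E}_{\mathsf{RGG}}f(\mathbf{G})-\mathbf{E}_{\mathsf{G}(n,p)}f(\mathbf{G})\big| = o\Big(\sqrt{\mathrm{Var}_{\mathsf{G}(n,p)}f+\mathrm{Var}_{\mathsf{RGG}}f}\Big).$$
   Context: Torus $\mathbb{T}^d=\mathbb{R}^d/2\mathbb{Z}^d$ with uniform measure; circular distance $|x-y|_C\in[0,1]$ on a circle of circumference 2; $\|\mathbf{x}-\mathbf{y}\|_\infty=\max_i|x_i-y_i|_C$; $\tau^\infty_p$ satisfies $\mathbf{P}[\|\mathbf{x}-\mathbf{y}\|_\infty\le\tau^\infty_p]=p$ for iid uniform $\mathbf{x},\mathbf{y}$. $\mathsf{RGG}(n,\mathbb{T}^d,\mathsf{Unif},\sigma^\infty_p,p)$: iid uniform latent points $\mathbf{x}^1,\dots,\mathbf{x}^n$, edge $ij$ iff $\|\mathbf{x}^i-\mathbf{x}^j\|_\infty\le\tau^\infty_p$. $\mathsf{G}(n,p)$ is Erdős–Rényi. Assumption (A): absolute constants $\delta,\epsilon>0$ with $n^{-1+\epsilon}\le p\le1/2$ and $n^\delta\le d$.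 Polynomials are real polynomials in the $\binom n2$ edge indicator variables. *)

(* Defs.v *)
From HB Require Import structures.
From mathcomp Require Import all_boot all_order all_algebra.
From mathcomp Require Import all_classical all_reals all_analysis.
From mathcomp Require mpoly.
Set Implicit Arguments. Unset Strict Implicit. Unset Printing Implicit Defensive.
Import Order.TTheory GRing.Theory Num.Theory.
Import numFieldNormedType.Exports.
Local Open Scope classical_set_scope.
Local Open Scope ring_scope.

Section Defs.
Variable R : realType.

(** Circular distance on a circle of circumference 2 (the circle R/2Z):
    |x - y|_C in [0,1]. *)
Definition circ_dist (x y : R) : R :=
  let t := x - y in
  let r := t - 2 * (Num.floor (t / 2))%:~R in
  Num.min r (2 - r).

Definition linf_dist (dim : nat) (x y : 'I_dim -> R) : R :=
  \big[Num.max/0]_(k < dim) circ_dist (x k) (y k).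

Definition edge (n : nat) := {e : {set 'I_n} | #|e| == 2%N}.
Definition graph (n : nat) := {set edge n}.

(** Number of edge variables = binom(n,2); polynomials are real polynomials
    in these edge indicator variables (variable i <-> edge enum_val i). *)
Definition nedges (n : nat) := #|{: edge n}|.
Definition edgepoly (n : nat) := mpoly.mpoly (nedges n) R.

(** total degree of an edge polynomial (degree of 0 is taken to be 0) *)
Definition edgepoly_deg (n : nat) (g : edgepoly n) : nat :=
  \max_(m <- mpoly.msupp g) mpoly.mdeg m.

Definition eval_graph (n : nat) (g : edgepoly n) (G : graph n) : R :=
  mpoly.meval (fun i : 'I_(nedges n) => if enum_val i \in G then 1 else 0) g.

Definition er_prob (n : nat) (p : R) (G : graph n) : R :=
  p ^+ #|G| * (1 - p) ^+ (nedges n - #|G|).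

Definition gmean (n : nat) (w : graph n -> R) (h : graph n -> R) : R :=
  \sum_(G : graph n) w G * h G.
Definition gvar (n : nat) (w : graph n -> R) (h : graph n -> R) : R :=
  gmean w (fun G => h G ^+ 2) - (gmean w h) ^+ 2.

(** The X i k (i : vertex, k : coordinate) are i.i.d. uniform on [0,2)
    (the fundamental domain of R/2Z), i.e. the latent points X i are i.i.d.
    uniform on the torus: every X i k is measurable and for every family of
    Borel sets the joint probability factorizes into uniform marginals. *)
Definition iid_unif_torus (d0 : measure_display) (T : measurableType d0)
    (P : probability T R) (n dim : nat) (X : 'I_n -> 'I_dim -> T -> R) :=
  (forall i k, measurable_fun setT (X i k)) /\
  forall B : 'I_n -> 'I_dim -> set R,
    (forall i k, measurable (B i k)) ->
    P (\bigcap_(i in [set: 'I_n]) \bigcap_(k in [set: 'I_dim]) (X i k @^-1` B i k))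
    = (\prod_(i < n) \prod_(k < dim)
         (lebesgue_measure (B i k `&` `[0%R, 2%R[) * (2^-1)%:E))%E.

Definition rgg_graph (T : Type) (n dim : nat) (X : 'I_n -> 'I_dim -> T -> R)
    (tau : R) (w : T) : graph n :=
  finset (fun e : edge n => [forall i in val e, [forall j in val e,
       linf_dist (X i ^~ w) (X j ^~ w) <= tau]]).

Definition rgg_prob (d0 : measure_display) (T : measurableType d0)
    (P : probability T R) (n dim : nat) (X : 'I_n -> 'I_dim -> T -> R)
    (tau : R) (G : graph n) : R :=
  fine (P [set w | rgg_graph X tau w = G]).

End Defs.

(* Main.v *)
Require Import Defs.
From HB Require Import structures.
From mathcomp Require Import all_boot all_order all_algebra.
From mathcomp Require Import all_classical all_reals all_analysis.
From mathcomp Require mpoly.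
From mathcomp Require Import measurable_realfun ring lra zify.
Import Order.TTheory GRing.Theory Num.Theory.
Import numFieldNormedType.Exports.
Local Open Scope ring_scope.
Set Implicit Arguments. Unset Strict Implicit. Unset Printing Implicit Defensive.

(** Expand a polynomial in the products [chi_H] of the centred edge indicators, an
    orthogonal basis under [G(n,p)]: by Cauchy-Schwarz it is enough that the squared
    normalised Fourier coefficients of the geometric graph over [0 < |H| <= D] add up to [o(1)].

    Rounding every coordinate to a grid of [M] points and letting [M] tend to infinity
    replaces the torus by a finite group; in one coordinate an edge is _far_ with
    probability [dens ~ ln(1/p) / d], and an edge is present iff it is far in no coordinate.
    The normalised coefficient [Psi H] is a sum, over the [d]-tuples of edge sets with union
    [H], of products of one-coordinate weights [W A].  The weight [W A] vanishes when [A] has a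
    vertex of degree one, and otherwise [|W A| <= (2 dens)^(v(A)/2 + 1)]: an edge set of minimum
    degree two contains a forest with at least [2 v(A) / 3] edges, and on three vertices the
    far relation contains no triangle.  Weighting each covered vertex by [b = d^(1/2 - o(1))]
    makes the sum over tuples bounded, so [|Psi H| <= 2 b^(-v(H))].  As [|H| >= v(H)] whenever
    [Psi H <> 0] and there are [n^(o(v))] edge sets of size at most [D] on [v] given vertices,
    the total is about [sum_v (n p / d^(1 - o(1)))^v], which is small once [d >= (np)^(1 + o(1))]. *)


(** * Edge sets: covered vertices, minimum degree two, and forests inside them *)

Section EdgeSets.
Import mathcomp.boot.fintype mathcomp.boot.finset.
Variable n : nat.
Implicit Types (A B H T : {set edge n}) (e : edge n) (x y : 'I_n).

Definition covered A : {set 'I_n} := \bigcup_(e in A) val e.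
Definition deg A x := #|[set e in A | x \in val e]|.
(** Degree zero is allowed, so vertices outside [covered A] impose nothing: the condition says that
    every covered vertex has degree at least two. *)
Definition leafless A := [forall x, deg A x != 1%N].

Lemma edge_other e x : x \in val e -> exists2 y, y != x & val e = [set x; y].
Proof.
move=> xe.
have /cards2P[a [b [ab E]]] := valP e; move: xe; rewrite E !inE => /orP[] /eqP ->.
  by exists b; rewrite 1?eq_sym.
by exists a => //; rewrite setUC.
Qed.

Lemma edge_inj e e' x y :
  x != y -> x \in val e -> y \in val e -> x \in val e' -> y \in val e' -> e = e'.
Proof.
move=> xy xe ye xe' ye'; apply: val_inj.
have [z zx Ez] := edge_other xe; have [z' zx' Ez'] := edge_other xe'.
move: ye ye'; rewrite Ez Ez' !inE eq_sym (negbTE xy) /=.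
by move=> /eqP <- /eqP <-.
Qed.

Lemma coveredP A x : reflect (exists2 e, e \in A & x \in val e) (x \in covered A).
Proof. exact: bigcupP. Qed.

Lemma coveredU A B : covered (A :|: B) = covered A :|: covered B.
Proof. exact: bigcup_setU. Qed.

Lemma covered1 e : covered [set e] = val e.
Proof. exact: big_set1. Qed.

Lemma covered0 : covered set0 = set0.
Proof. exact: big_set0. Qed.

Lemma coveredS A B : A \subset B -> covered A \subset covered B.
Proof.
move=> AB; apply/fintype.subsetP => x /coveredP[e eA xe].
by apply/coveredP; exists e => //; exact: (fintype.subsetP AB).
Qed.

Lemma covered_eq0 A : (covered A == set0) = (A == set0).
Proof.
apply/eqP/eqP => [vA|->]; last exact: covered0.
apply/eqP; apply: contraT => /set0Pn[e eA].
have /card_gt0P[x xe] : (0 < #|val e|)%N by rewrite (eqP (valP e)).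
have : x \in covered A by apply/coveredP; exists e.
by rewrite vA inE.
Qed.

Lemma covered_bigcup (I : finType) (f : I -> {set edge n}) :
  covered (\bigcup_i f i) = \bigcup_i covered (f i).
Proof.
apply/setP => x; apply/coveredP/bigcupP.
  by move=> [e /bigcupP[i _ ei] xe]; exists i => //; apply/coveredP; exists e.
by move=> [i _ /coveredP[e ei xe]]; exists e => //; apply/bigcupP; exists i.
Qed.

Lemma card_covered_le A : (#|covered A| <= 2 * #|A|)%N.
Proof.
rewrite /covered; apply: (@leq_trans (\sum_(e in A) #|val e|)).
  elim/big_rec2: _ => [|e m B _ h]; first by rewrite cards0.
  by apply: (leq_trans (leq_card_setU _ _)); rewrite leq_add2l.
by rewrite (eq_bigr (fun=> 2%N)) ?sum_nat_const 1?mulnC // => e _; apply/eqP/(valP e).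
Qed.

Lemma leaflessP A : reflect (forall x, x \in covered A -> (2 <= deg A x)%N) (leafless A).
Proof.
apply: (iffP forallP) => [h x /coveredP[e eA xe]|h x].
  have := h x; suff : (0 < deg A x)%N by clear; lia.
  by apply/card_gt0P; exists e; rewrite inE eA.
apply/eqP => d1; have /card_gt0P[e] : (0 < deg A x)%N by rewrite d1.
rewrite inE => /andP[eA xe]; have := h x; rewrite d1 => /(_ _).
by have -> : x \in covered A by [apply/coveredP; exists e]; move/(_ isT).
Qed.

Lemma leafless_two A x : leafless A -> x \in covered A ->
  exists e1 e2, [/\ e1 \in A, e2 \in A, e1 != e2, x \in val e1 & x \in val e2].
Proof.
move=> /leaflessP/(_ x) h /h /card_gt1P[e1 [e2]] [].
rewrite !inE => /andP[? ?] /andP[? ?] ?.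
by exists e1, e2.
Qed.

Lemma card_edgesin A (S : {set 'I_n}) :
  (forall e, e \in A -> val e \subset S) -> (#|A| <= 'C(#|S|, 2))%N.
Proof.
move=> h; rewrite -cards_draws -(card_imset _ val_inj).
apply: subset_leq_card; apply/fintype.subsetP => z /imsetP[e eA ->].
by rewrite inE h //= (valP e).
Qed.

Lemma sub_covered A e : e \in A -> val e \subset covered A.
Proof. by move=> eA; apply/fintype.subsetP => x xe; apply/coveredP; exists e. Qed.

(** Double counting of incidences: each edge has two endpoints, and each covered vertex lies on at
    least two edges. *)
Lemma leafless_card A : leafless A -> (#|covered A| <= #|A|)%N.
Proof.
move=> /leaflessP h.
suff : (2 * #|covered A| <= 2 * #|A|)%N by rewrite leq_pmul2l.
have -> : (2 * #|A| = \sum_(e in A) #|val e|)%N.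
  by rewrite (eq_bigr (fun=> 2%N)) ?sum_nat_const 1?mulnC // => e _; apply/eqP/(valP e).
rewrite (eq_bigr (fun e => \sum_(x in covered A) (x \in val e : nat))%N); last first.
  move=> e eA; rewrite -sum1_card big_mkcond /= [RHS]big_mkcond /=.
  apply: eq_bigr => x _; case: (boolP (x \in val e)) => [xe|]; last by case: ifP.
  by rewrite (fintype.subsetP (sub_covered eA)).
rewrite exchange_big /= mulnC -sum_nat_const; apply: leq_sum => x /h.
rewrite /deg -sum1_card; under [X in (_ <= X -> _)%N]eq_bigl do rewrite inE.
by rewrite big_mkcondr.
Qed.

Lemma leafless_bigcup (I : finType) (f : I -> {set edge n}) :
  (forall i, leafless (f i)) -> leafless (\bigcup_i f i).
Proof.
move=> h; apply/leaflessP => x; rewrite covered_bigcup => /bigcupP[i _ xi].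
apply: (leq_trans (leaflessP _ (h i) x xi)); apply: subset_leq_card.
apply/fintype.subsetP => e; rewrite !inE => /andP[ei ->]; rewrite andbT.
by apply/bigcupP; exists i.
Qed.

(** Combines a global size bound [r * r] with the quadratic bound for edges on [v] vertices into one
    linear in [v], so that counts of edge sets become [v]-th powers. *)
Lemma card_le_mul (k v r : nat) : (k <= r * r)%N -> (k <= v * v)%N -> (k <= r * v)%N.
Proof.
move=> kr kv; case: (leqP v r) => rv.
  by apply: (leq_trans kv); rewrite leq_mul2r rv orbT.
by apply: (leq_trans kr); rewrite leq_mul2l (ltnW rv) orbT.
Qed.

Lemma bin2_le_sqr m : ('C(m, 2) <= m * m)%N.
Proof.
by rewrite bin2 -divn2 (leq_trans (leq_div _ _)) // leq_mul2l leq_pred orbT.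
Qed.

(** A forest is given by an order of construction in which each new edge brings a fresh vertex;
    averages over it can then be computed by removing the last edge first. *)
Inductive forest : {set edge n} -> Prop :=
| forest0 : forest set0
| forestU T e x of forest T & x \in val e & x \notin covered T : forest (e |: T).

Lemma notin_covered T e x : x \in val e -> x \notin covered T -> e \notin T.
Proof. by move=> xe; apply: contra => eT; apply/coveredP; exists e. Qed.

(** An uncovered vertex [x] of [A] has two edges. If one of them leads to a covered vertex, adding
    it gains one vertex for one edge; otherwise adding both gains three vertices for two edges.
    Either way [2 v <= 3 e] survives. *)
Lemma forest_grow A T : leafless A -> forest T -> T \subset A ->
  (2 * #|covered T| <= 3 * #|T|)%N ->
  exists T', [/\ forest T', T' \subset A & (2 * #|covered A| <= 3 * #|T'|)%N].
Proof.
move=> lA; have [k] := ubnP (#|A| - #|T|)%N.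
elim: k T => // k IH T hk fT TA hT.
case: (boolP (covered A \subset covered T)) => [vAT|/subsetPn[x xA xT]].
  exists T; split => //; apply: leq_trans hT.
  by rewrite leq_mul2l subset_leq_card.
have [e1 [e2 [e1A e2A e12 xe1 xe2]]] := leafless_two lA xA.
have step1 e : e \in A -> x \in val e -> forall y, val e = [set x; y] ->
   y \in covered T -> exists T', [/\ forest T', T' \subset A & (2 * #|covered A| <= 3 * #|T'|)%N].
  move=> eA xe y ey yT; have eT := notin_covered xe xT.
  have eTA : e |: T \subset A by rewrite subUset sub1set eA.
  apply: (IH (e |: T)) => //.
  - by move: hk (subset_leq_card eTA); rewrite cardsU1 eT; move: #|A| #|T| => a t; clear; lia.
  - exact: forestU xT.
  - have -> : covered (e |: T) = x |: covered T.
      rewrite coveredU covered1 ey -setUA; congr (_ :|: _).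
      by apply/setUidPr; rewrite sub1set.
    by move: hT; rewrite !cardsU1 xT eT; move: #|covered T| #|T| => a t; clear; lia.
have [y1 y1x ey1] := edge_other xe1; have [y2 y2x ey2] := edge_other xe2.
case: (boolP (y1 \in covered T)) => [|y1T]; first exact: step1 ey1.
case: (boolP (y2 \in covered T)) => [|y2T]; first exact: step1 ey2.
have y12 : y2 != y1.
  apply: contra e12 => /eqP yy; apply/eqP; apply: val_inj.
  by rewrite ey1 ey2 yy.
have e1T := notin_covered xe1 xT.
have v1 : covered (e1 |: T) = [set x; y1] :|: covered T by rewrite coveredU covered1 ey1.
have y2e2 : y2 \in val e2 by rewrite ey2 !inE eqxx orbT.
have y2T1 : y2 \notin covered (e1 |: T).
  by rewrite v1 !inE (negbTE y2x) (negbTE y12) (negbTE y2T).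
have e2T1 := notin_covered y2e2 y2T1.
have sA : e2 |: (e1 |: T) \subset A by rewrite !subUset !sub1set e1A e2A.
have c : #|e2 |: (e1 |: T)| = (#|T|.+2)%N by rewrite !cardsU1 e2T1 e1T.
apply: (IH (e2 |: (e1 |: T))) => //.
- by move: hk (subset_leq_card sA); rewrite c; move: #|A| #|T| => a t; clear; lia.
- by apply: (forestU (x := y2)) => //; apply: (forestU (x := x)).
- rewrite c coveredU covered1 v1 ey2.
  have -> : [set x; y2] :|: ([set x; y1] :|: covered T) = y2 |: (y1 |: (x |: covered T)).
    apply/setP => z; rewrite !inE; case: (z == x); case: (z == y1); case: (z == y2);
    by case: (z \in covered T).
  move: hT; rewrite !cardsU1; case: (_ \notin _); case: (_ \notin _); case: (_ \notin _);
  move: #|covered T| #|T| => a t; clear; lia.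
Qed.

Lemma leafless_forest A : leafless A ->
  exists T, [/\ forest T, T \subset A & (2 * #|covered A| <= 3 * #|T|)%N].
Proof.
move=> lA; apply: (forest_grow lA forest0 (sub0set _)).
by rewrite covered0 !cards0.
Qed.

Lemma leafless_card_ge3 A : leafless A -> A != set0 -> (3 <= #|covered A|)%N.
Proof.
move=> lA; rewrite -covered_eq0 => /set0Pn[x xA].
have [e1 [e2 [e1A e2A e12 xe1 xe2]]] := leafless_two lA xA.
have [y1 y1x ey1] := edge_other xe1; have [y2 y2x ey2] := edge_other xe2.
have y12 : y2 != y1.
  apply: contra e12 => /eqP yy; apply/eqP; apply: val_inj.
  by rewrite ey1 ey2 yy.
have : x |: [set y1; y2] \subset covered A.
  rewrite !subUset !sub1set xA /=; apply/andP; split; apply/coveredP.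
    by exists e1 => //; rewrite ey1 !inE eqxx orbT.
  by exists e2 => //; rewrite ey2 !inE eqxx orbT.
move=> /subset_leq_card; rewrite cardsU1 !inE cards2.
by rewrite eq_sym (negbTE y1x) eq_sym (negbTE y2x) (eq_sym y1) y12.
Qed.

(** Three vertices of degree at least two need all three possible edges. This shape is isolated
    because a forest in it has only two edges, too few for the bound on [W]. *)
Lemma leafless_triangle A : leafless A -> #|covered A| = 3%N ->
  exists x y z e1 e2 e3, [/\ uniq [:: x; y; z], uniq [:: e1; e2; e3],
   A = [set e1; e2; e3] & [/\ val e1 = [set x; y], val e2 = [set y; z] & val e3 = [set x; z]]].
Proof.
move=> lA v3.
have /set0Pn[x xA] : covered A != set0 by rewrite -card_gt0 v3.
have [e1 [e3 [e1A e3A e13 xe1 xe3]]] := leafless_two lA xA.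
have [y yx ey] := edge_other xe1; have [z zx ez] := edge_other xe3.
have yz : y != z.
  by apply: contra e13 => /eqP yy; apply/eqP; apply: val_inj; rewrite ey ez yy.
have ye1 : y \in val e1 by rewrite ey !inE eqxx orbT.
have ze3 : z \in val e3 by rewrite ez !inE eqxx orbT.
have yA : y \in covered A by apply/coveredP; exists e1.
have zA : z \in covered A by apply/coveredP; exists e3.
have vA : covered A = x |: [set y; z].
  apply/esym/eqP; rewrite eqEcard v3 !subUset !sub1set xA yA zA /=.
  by rewrite cardsU1 cards2 !inE eq_sym (negbTE yx) eq_sym (negbTE zx) yz.
have other e : e \in A -> forall w, w \in val e -> [|| w == x, w == y | w == z].
  move=> eA w we; have : w \in covered A by apply/coveredP; exists e.
  by rewrite vA !inE.
have [f1 [f2 [f1A f2A f12 yf1 yf2]]] := leafless_two lA yA.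
have [e2 e2A [ye2 e12]] : exists2 e2, e2 \in A & y \in val e2 /\ e2 != e1.
  case: (eqVneq f1 e1) => [<-|h]; last by exists f1.
  by exists f2 => //; rewrite eq_sym.
have [w wy ew] := edge_other ye2.
have we2 : w \in val e2 by rewrite ew !inE eqxx orbT.
have wz : w = z.
  have := other _ e2A _ we2; rewrite (negbTE wy) /=.
  case: (eqVneq w x) => [wx _|_ /= /eqP //].
  move: e12; rewrite (@edge_inj e2 e1 x y) ?eqxx //; first by rewrite eq_sym.
  by rewrite -wx.
rewrite {w}wz in wy ew we2.
have e23 : e2 != e3.
  apply/eqP => h; move: ye2; rewrite h ez !inE (negbTE yx) (negbTE yz) //.
exists x, y, z, e1, e2, e3; split => //.
- by rewrite /= !inE negb_or (eq_sym x y) (eq_sym x z) yx zx yz.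
- by rewrite /= !inE negb_or (eq_sym e1 e2) e12 e13 e23.
apply/eqP; rewrite eq_sym eqEcard; apply/andP; split.
  by rewrite !subUset !sub1set e1A e2A e3A.
have -> : #|[set e1; e2; e3]| = 3%N.
  rewrite setUC cardsU1 cards2 !inE !negb_or.
  by rewrite (eq_sym e3) e13 (eq_sym e3) e23 eq_sym e12.
by have := card_edgesin (@sub_covered A); rewrite v3 /=.
Qed.

End EdgeSets.

(** * One coordinate on a finite group: the far relation and the weight [W] *)

Section OneCoordinate.
Import mathcomp.boot.fintype mathcomp.boot.finset.
Variables (R : realFieldType) (Z : finZmodType) (S : {set Z}) (n : nat).
Implicit Types (A B H T : {set edge n}) (e : edge n) (x : {ffun 'I_n -> Z}).

(** An edge is an unordered set, hence the quantification over both endpoints; for a symmetric [S]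
    without [0], [farE] reduces it to a single difference. *)
Definition far e x := [exists i in val e, exists j in val e, x i - x j \in S].
Definition avg (phi : {ffun 'I_n -> Z} -> R) : R :=
  (#|Z|%:R ^+ n)^-1 * \sum_x phi x.
Definition dens : R := #|S|%:R / #|Z|%:R.

Lemma cardZ_gt0 : 0 < #|Z|%:R :> R.
Proof. by rewrite ltr0n; apply/card_gt0P; exists 0. Qed.

Lemma eq_avg phi psi : phi =1 psi -> avg phi = avg psi.
Proof. by move=> h; rewrite /avg; congr (_ * _); apply: eq_bigr. Qed.

Lemma avg_cst c : avg (fun=> c) = c.
Proof.
rewrite /avg sumr_const card_ffun card_ord -[c *+ _]mulr_natr natrX mulrC mulfK //.
by rewrite expf_neq0 // gt_eqF // cardZ_gt0.
Qed.

Lemma avgD phi psi : avg (fun x => phi x + psi x) = avg phi + avg psi.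
Proof. by rewrite /avg big_split mulrDr. Qed.

Lemma avgZ c phi : avg (fun x => c * phi x) = c * avg phi.
Proof. by rewrite /avg -mulr_sumr mulrCA. Qed.

Lemma avg_sum (I : finType) (P : pred I) (F : I -> {ffun 'I_n -> Z} -> R) :
  avg (fun x => \sum_(i | P i) F i x) = \sum_(i | P i) avg (F i).
Proof. by rewrite /avg exchange_big mulr_sumr. Qed.

Lemma ler_avg phi psi : (forall x, phi x <= psi x) -> avg phi <= avg psi.
Proof.
move=> h; rewrite ler_pM2l ?ler_sum // invr_gt0 exprn_gt0 //; exact: cardZ_gt0.
Qed.

Lemma ler_norm_avg phi : `|avg phi| <= avg (fun x => `|phi x|).
Proof.
rewrite normrM ger0_norm; last by rewrite invr_ge0 exprn_ge0 // ltW // cardZ_gt0.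
rewrite ler_pM2l; first exact: ler_norm_sum.
by rewrite invr_gt0 exprn_gt0 //; exact: cardZ_gt0.
Qed.

Definition upd (a : 'I_n) (s : Z) x : {ffun 'I_n -> Z} :=
  [ffun i => if i == a then x i + s else x i].

Lemma updK a s : cancel (upd a s) (upd a (- s)).
Proof. by move=> x; apply/ffunP => i; rewrite !ffunE; case: (i == a); rewrite ?addrK. Qed.

Lemma upd_bij a s : bijective (upd a s).
Proof.
exists (upd a (- s)); first exact: updK.
by move=> x; rewrite -{1}[s]opprK updK.
Qed.

(* Averaging over the translates of the a-th coordinate decouples [x a - x b] from [phi]. *)
Lemma avg_leaf (phi : {ffun 'I_n -> Z} -> R) (h : Z -> R) (a b : 'I_n) :
  b != a -> (forall s x, phi (upd a s x) = phi x) ->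
  avg (fun x => phi x * h (x a - x b)) = avg phi * (#|Z|%:R^-1 * \sum_s h s).
Proof.
move=> ba hphi.
have Z0 : #|Z|%:R != 0 :> R by rewrite gt_eqF // cardZ_gt0.
rewrite /avg -mulrA; congr (_ * _); apply: (mulfI Z0).
rewrite mulrCA mulVKf // mulr_natl -sumr_const.
transitivity (\sum_(s : Z) \sum_x phi x * h (x a - x b + s)).
  apply: eq_bigr => s _; rewrite (reindex _ (onW_bij _ (upd_bij a s))) /=.
  apply: eq_bigr => x _; rewrite hphi !ffunE eqxx (negbTE ba).
  by rewrite addrAC.
rewrite exchange_big mulr_suml; apply: eq_bigr => x _.
rewrite -mulr_sumr; congr (_ * _).
by rewrite [RHS](reindex_inj (addrI (x a - x b))).
Qed.

Hypothesis symS : forall s, (- s \in S) = (s \in S).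
Hypothesis S0 : 0 \notin S.

Lemma farE e a b x : val e = [set a; b] -> far e x = (x a - x b \in S).
Proof.
move=> E; apply/existsP/idP.
  move=> [i]; rewrite E => /andP[ie] /existsP[j /andP[]]; move: ie.
  rewrite !inE => /orP[] /eqP -> /orP[] /eqP ->; rewrite ?subrr ?(negbTE S0) //.
  by rewrite -symS opprB.
move=> h; exists a; rewrite E !inE eqxx /=; apply/existsP; exists b.
by rewrite !inE eqxx orbT h.
Qed.

(** The difference across [e] is uniform on the group and independent of any function that ignores
    the endpoint [a]. *)
Lemma avg_far (phi : {ffun 'I_n -> Z} -> R) (h : bool -> R) (e : edge n) (a : 'I_n) :
  a \in val e -> (forall s x, phi (upd a s x) = phi x) ->
  avg (fun x => phi x * h (far e x)) =
  avg phi * (dens * h true + (1 - dens) * h false).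
Proof.
move=> ae hphi; have [b ba E] := edge_other ae.
rewrite (eq_avg (psi := fun x => phi x * h (x a - x b \in S))); last first.
  by move=> x; rewrite (farE _ E).
rewrite (avg_leaf (fun s => h (s \in S)) ba hphi); congr (_ * _).
rewrite (bigID (mem S)) /= (eq_bigr (fun=> h true)); last by move=> i ->.
rewrite [X in _ + X](eq_bigr (fun=> h false)); last by move=> i /negbTE ->.
have Z0 : #|Z|%:R != 0 :> R by rewrite gt_eqF // cardZ_gt0.
rewrite !sumr_const.
have -> : #|[pred i | i \notin S]| = (#|Z| - #|S|)%N.
  by rewrite -(cardC S) addKn; apply: eq_card => i; rewrite !inE.
rewrite -!(mulr_natr (h _)) natrB ?max_card // /dens; field.
exact: Z0.
Qed.

Lemma prod_far_upd T (h : bool -> R) a s x : a \notin covered T ->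
  \prod_(e in T) h (far e (upd a s x)) = \prod_(e in T) h (far e x).
Proof.
move=> aT; apply: eq_bigr => e eT; congr (h _).
rewrite /far; apply: eq_existsb => i; case: (boolP (i \in val e)) => //= ie.
apply: eq_existsb => j; case: (boolP (j \in val e)) => //= je.
have ne k : k \in val e -> (k == a) = false.
  by move=> ke; apply: contraNF aT => /eqP <-; apply/coveredP; exists e.
by rewrite !ffunE !ne.
Qed.

(** Edges of a forest are independent: the last edge added has an endpoint that the others do not
    see, so [avg_far] splits it off. *)
Lemma avg_forest T (h : bool -> R) : forest T ->
  avg (fun x => \prod_(e in T) h (far e x)) =
  (dens * h true + (1 - dens) * h false) ^+ #|T|.
Proof.
elim=> [|{}T e a fT IH ae aT].
  by rewrite cards0 expr0 (eq_avg (psi := fun=> 1)) ?avg_cst // => x; rewrite big_set0.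
have eT := notin_covered ae aT.
rewrite cardsU1 eT exprSr -IH -(avg_far h ae); last by move=> s x; rewrite prod_far_upd.
by apply: eq_avg => x; rewrite big_setU1 //= mulrC.
Qed.

(* Centred so that [1 - far = (1 - dens) * (1 + edge_weight)] with [edge_weight] of mean zero. *)
Definition edge_weight e x : R := (dens - (far e x)%:R) / (1 - dens).
Definition W A : R := avg (fun x => \prod_(e in A) edge_weight e x).

Lemma W_set0 : W set0 = 1.
Proof. by rewrite /W (eq_avg (psi := fun=> 1)) ?avg_cst // => x; rewrite big_set0. Qed.

Hypothesis dens_le : dens <= 3^-1.

Lemma dens_ge0 : 0 <= dens.
Proof. by rewrite divr_ge0. Qed.

(** The edge at a vertex of degree one is independent of all other factors, and its centred weight
    has mean zero. *)
Lemma W_leaf A : ~~ leafless A -> W A = 0.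
Proof.
move=> /forallPn[a]; rewrite negbK => /cards1P[e E].
have : e \in [set e0 in A | a \in val e0] by rewrite E set11.
rewrite inE => /andP[eA ae].
have aT : a \notin covered (A :\ e).
  apply/coveredP => -[e']; rewrite !inE => /andP[e'e e'A] ae'.
  have : e' \in [set e0 in A | a \in val e0] by rewrite inE e'A.
  by rewrite E inE (negbTE e'e).
rewrite /W (eq_avg (psi := fun x => (\prod_(e0 in A :\ e) edge_weight e0 x) * edge_weight e x)); last first.
  by move=> x; rewrite (big_setD1 e) //= mulrC.
have h := avg_far (fun b => (dens - b%:R) / (1 - dens)) ae.
rewrite h; last first.
  by move=> s x; rewrite (prod_far_upd (fun b => (dens - b%:R) / (1 - dens)) _ _ aT).
have d0 := dens_ge0; have d1 := dens_le.
rewrite [X in _ * X](_ : _ = 0) ?mulr0 // /= mulr1n mulr0n; field.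
by apply/eqP; lra.
Qed.

Lemma norm_edge_weight_le1 e x : `|edge_weight e x| <= 1.
Proof.
have d0 := dens_ge0; have d1 := dens_le.
rewrite /edge_weight normrM normfV [X in _ / X]ger0_norm; last lra.
rewrite ler_pdivrMr; last lra.
by case: (far e x) => /=; rewrite ler_norml; lra.
Qed.

(** A far edge has weight of modulus 1 and any other edge [dens / (1 - dens)], so the mean modulus
    is [dens + dens]. *)
Lemma avg_norm_forest T : forest T ->
  avg (fun x => \prod_(e in T) `|edge_weight e x|) = (2 * dens) ^+ #|T|.
Proof.
move=> fT; rewrite (avg_forest (fun b => `|(dens - b%:R) / (1 - dens)|) fT).
congr (_ ^+ _); have d0 := dens_ge0; have d1 := dens_le.
rewrite !normrM normfV (ger0_norm (x := 1 - dens)); last lra.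
rewrite (ler0_norm (x := dens - true%:R)) ?(ger0_norm (x := dens - false%:R)) /= ?mulr1n ?mulr0n; try lra.
field; apply/eqP; lra.
Qed.

Lemma norm_W_forest A T : forest T -> T \subset A -> `|W A| <= (2 * dens) ^+ #|T|.
Proof.
move=> fT TA; rewrite -(avg_norm_forest fT).
apply: (le_trans (ler_norm_avg _)); apply: ler_avg => x.
rewrite normr_prod (big_setID T) /= (setIidPr TA).
rewrite ler_piMr //; first by apply: prodr_ge0.
apply: (@le_trans _ _ (\prod_(e in A :\: T) 1)); last by rewrite big1_eq.
by apply: ler_prod => e _; rewrite normr_ge0 norm_edge_weight_le1.
Qed.

Hypothesis sumfree : forall a b c, a \in S -> b \in S -> c \in S -> a + b + c != 0.

(** Any two edges of a triangle form a forest and are independent, while the three are never far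
    together; expanding the product therefore determines [W] exactly. *)
Lemma W_triangle A : leafless A -> #|covered A| = 3%N -> `|W A| <= (2 * dens) ^+ 3.
Proof.
move=> lA v3; have [a [b [c [e1 [e2 [e3 [uv ue EA [E1 E2 E3]]]]]]]] := leafless_triangle lA v3.
have d0 := dens_ge0; have d1 := dens_le.
move: uv ue; rewrite /= !inE !andbT !negb_or => /andP[/andP[ab ac] bc] /andP[/andP[e12 e13] e23].
(* The three differences around the triangle add up to zero, which [sumfree] forbids for elements of
   [S]. *)
have f3 x : ~~ [&& far e1 x, far e2 x & far e3 x].
  rewrite (farE x E1) (farE x E2) (farE x E3); apply/negP => /and3P[h1 h2].
  rewrite -symS => h3; have := sumfree h1 h2 h3.
  by rewrite addrA subrK subrr eqxx.
have ae1 : a \in val e1 by rewrite E1 !inE eqxx.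
have be2 : b \in val e2 by rewrite E2 !inE eqxx.
have ce3 : c \in val e3 by rewrite E3 !inE eqxx orbT.
have fo1 e : forest [set e].
  have /card_gt0P[z ze] : (0 < #|val e|)%N by rewrite (eqP (valP e)).
  by rewrite -(setU0 [set e]); apply: (forestU (x := z) (forest0 n)) => //; rewrite covered0 inE.
have fo2 e e' z : z \in val e -> z \notin val e' -> forest [set e; e'].
  by move=> ze ze'; apply: (forestU (x := z)) => //; rewrite covered1.
have f12 : forest [set e1; e2].
  by apply: (fo2 _ _ a) => //; rewrite E2 !inE negb_or ab ac.
have f13 : forest [set e1; e3].
  by apply: (fo2 _ _ b); rewrite ?E1 ?E3 !inE ?eqxx ?orbT // negb_or eq_sym ab bc.
have f23 : forest [set e2; e3].
  by apply: (fo2 _ _ b) => //; rewrite E3 !inE negb_or eq_sym ab bc.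
pose m e x : R := (far e x)%:R.
have M1 e : avg (m e) = dens.
  have := avg_forest (fun b => b%:R) (fo1 e); rewrite cards1 expr1 mulr1 mulr0 addr0 => <-.
  by apply: eq_avg => x; rewrite big_set1.
have M2 e e' : e != e' -> forest [set e; e'] -> avg (fun x => m e x * m e' x) = dens ^+ 2.
  move=> ee' fe; have := avg_forest (fun b => b%:R) fe.
  rewrite cards2 ee' mulr1 mulr0 addr0 => <-; apply: eq_avg => x.
  by rewrite big_setU1 ?inE // big_set1.
have := M2 _ _ e12 f12; have := M2 _ _ e13 f13; have := M2 _ _ e23 f23.
have := M1 e1; have := M1 e2; have := M1 e3.
move=> m3 m2 m1 m23 m13 m12.
(* The terms with no, one and two far indicators contribute [1 - 3 + 3] times [dens ^+ 3], and the
   triple term is zero. *)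
suff -> : W A = dens ^+ 3 / (1 - dens) ^+ 3.
  rewrite ger0_norm; last by rewrite divr_ge0 ?exprn_ge0 //; lra.
  rewrite -expr_div_n lerXn2r // ?nnegrE ?divr_ge0 //; try lra.
  rewrite ler_pdivrMr; last lra.
  by nra.
rewrite mulrC /W.
rewrite (eq_avg (psi := fun x => (1 - dens) ^- 3 * (dens ^+ 3
  + ((- dens ^+ 2) * m e1 x + (- dens ^+ 2) * m e2 x + (- dens ^+ 2) * m e3 x)
  + (dens * (m e1 x * m e2 x) + dens * (m e1 x * m e3 x) + dens * (m e2 x * m e3 x))))).
  rewrite avgZ !avgD avg_cst !avgZ m1 m2 m3 m12 m13 m23.
  by congr (_ * _); ring.
move=> x; rewrite EA -setUA big_setU1 ?inE ?negb_or ?e12 //= big_setU1 ?inE //= big_set1.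
rewrite /edge_weight -/(m e1 x) -/(m e2 x) -/(m e3 x).
have : m e1 x * m e2 x * m e3 x = 0.
  by have := f3 x; rewrite /m; do 3!case: (far _ x) => //=; rewrite ?mulr0 ?mul0r.
move=> m0.
have -> : (dens - m e1 x) / (1 - dens) * ((dens - m e2 x) / (1 - dens) * ((dens - m e3 x) / (1 - dens)))
  = (1 - dens) ^- 3 * ((dens - m e1 x) * (dens - m e2 x) * (dens - m e3 x)).
  by field; apply/eqP; lra.
congr (_ * _); rewrite -[LHS]addr0 -m0; ring.
Qed.

(* [s] stands for the square root of [2 * dens]. *)
Lemma norm_W_le A (s : R) : 0 <= s -> s ^+ 2 = 2 * dens ->
  leafless A -> A != set0 -> `|W A| <= s ^+ (#|covered A| + 2).
Proof.
move=> s0 s2 lA A0; have d0 := dens_ge0; have d1 := dens_le.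
have s1 : s <= 1.
  rewrite -(@expr_le1 _ 2) // s2; lra.
have v3 := leafless_card_ge3 lA A0.
(* As [s <= 1], a forest with [k] edges suffices once [2 k >= v + 2]. Given [2 v <= 3 k] and
   [v >= 3], this can fail only for [v = 3], [k = 2], which the triangle bound covers. *)
have key k : (#|covered A| + 2 <= 2 * k)%N -> (2 * dens) ^+ k <= s ^+ (#|covered A| + 2).
  by move=> hk; rewrite -s2 -exprM ler_wiXn2l.
case: (eqVneq #|covered A| 3%N) => [v3'|vn3].
  by apply: (le_trans (W_triangle lA v3')); apply: key; rewrite v3'.
have [T [fT TA hT]] := leafless_forest lA.
apply: (le_trans (norm_W_forest fT TA)); apply: key.
move: v3 vn3 hT; move: #|covered A| #|T| => v t; clear; lia.
Qed.

End OneCoordinate.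

(** * Sums over subsets and over tuples of sets with prescribed union *)

Section SubsetSums.
Import mathcomp.boot.fintype mathcomp.boot.finset.
Variables (R : realFieldType) (E : finType).
Implicit Types (A B H J U : {set E}).

Lemma prod_addr_subsets H (a b : E -> R) :
  \prod_(e in H) (a e + b e) =
  \sum_(J : {set E} | J \subset H) (\prod_(e in J) a e * \prod_(e in H :\: J) b e).
Proof.
rewrite big_mkcond /=.
rewrite (eq_bigr (fun e => (if e \in H then a e else 0) + (if e \in H then b e else 1))); last first.
  by move=> e _; case: ifP => // _; rewrite add0r.
rewrite bigA_distr /= [RHS]big_mkcond /=; apply: eq_bigr => J _.
case: ifP => [JH|/negbT/subsetPn[e eJ eH]]; last first.
  by rewrite (bigD1 e) //= eJ (negbTE eH) mul0r.
rewrite (bigID (mem J)) /=; congr (_ * _).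
  by apply: eq_bigr => e eJ; rewrite eJ (fintype.subsetP JH).
rewrite big_mkcond [RHS]big_mkcond /=; apply: eq_bigr => e _; rewrite inE.
by case: ifP => //=; case: ifP.
Qed.

Lemma sum_subset_pow U (z : R) :
  \sum_(J : {set E} | J \subset U) z ^+ #|J| = (1 + z) ^+ #|U|.
Proof.
rewrite addrC -[RHS]prodr_const prod_addr_subsets; apply: eq_bigr => J _.
by rewrite prodr_const big1_eq mulr1.
Qed.

(** In the induction step the excess term [2 m z^2] is at most [z], exactly because [m z <= 1/2]. *)
Lemma bernoulli_upper (m : nat) (z : R) : 0 <= z -> m%:R * z <= 2^-1 ->
  (1 + z) ^+ m <= 1 + 2 * (m%:R * z).
Proof.
move=> z0; elim: m => [|m IH]; first by rewrite expr0 mul0r mulr0 addr0.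
rewrite -natr1 exprSr => h.
have mz : 0 <= m%:R * z by rewrite mulr_ge0.
have := IH ltac:(nra); set q := (1 + z) ^+ m; move=> hq; nra.
Qed.

Lemma sum_nonempty_subset_pow U (z : R) : 0 <= z -> #|U|%:R * z <= 2^-1 ->
  \sum_(J : {set E} | (J \subset U) && (J != set0)) z ^+ #|J| <= 2 * (#|U|%:R * z).
Proof.
move=> z0 h; have := bernoulli_upper z0 h; rewrite -sum_subset_pow.
rewrite (bigD1 set0) ?sub0set //= cards0 expr0; lra.
Qed.

(** A set of at most [k] elements is the image of a list of length [k] padded with [None], which
    gives [#|U| + 1] choices for each place. *)
Lemma card_small_subsets U (k : nat) :
  (#|[set H : {set E} | (H \subset U) && (#|H| <= k)%N]| <= #|U|.+1 ^ k)%N.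
Proof.
pose Q : {set option E} := None |: [set Some e | e in U].
pose img (f : {ffun 'I_k -> option E}) := [set e | [exists i, f i == Some e]].
have cQ : #|Q| = #|U|.+1.
  rewrite cardsU1 card_imset; last by move=> ? ? [].
  by case: imsetP => // -[].
rewrite -[k in (_ ^ k)%N]card_ord -cQ -card_ffun_on.
apply: leq_trans (leq_imset_card img _); apply: subset_leq_card.
apply/fintype.subsetP => H; rewrite inE => /andP[HU Hk].
apply/imsetP; exists [ffun i : 'I_k => nth None (map Some (enum H)) i].
  apply/ffun_onP => i; rewrite ffunE; case: (ltnP i (size (enum H))) => hi.
    have /hasP : has predT (enum H) by rewrite has_predT; exact: leq_ltn_trans hi.
    move=> [e0 _ _]; rewrite (nth_map e0) // !inE; apply/orP; right.
    apply: imset_f; apply: (fintype.subsetP HU); rewrite -mem_enum; exact: mem_nth.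
  by rewrite nth_default ?size_map // !inE eqxx.
apply/setP => e; rewrite inE; apply/idP/existsP.
  move=> eH; have hi : (index e (enum H) < size (enum H))%N by rewrite index_mem mem_enum.
  have hk : (index e (enum H) < k)%N by apply: leq_trans hi _; rewrite -cardE.
  exists (Ordinal hk); rewrite ffunE (nth_map e) //= nth_index ?mem_enum //.
move=> [i]; rewrite ffunE; case: (ltnP i (size (enum H))) => hi; last first.
  by rewrite nth_default ?size_map.
rewrite (nth_map e) // => /eqP[<-]; rewrite -mem_enum; exact: mem_nth.
Qed.

Variable dim : nat.

(** Inclusion-exclusion: the power expands into tuples of subsets of [J], and the alternating sum
    over [J] between the union of a tuple and [H] vanishes unless the two coincide. *)
Lemma alternating_cover_sum (w : {set E} -> R) H :
  \sum_(J : {set E} | J \subset H) (-1) ^+ #|H :\: J| *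
     (\sum_(A : {set E} | A \subset J) w A) ^+ dim =
  \sum_(f : {ffun 'I_dim -> {set E}} | \bigcup_k f k == H) \prod_k w (f k).
Proof.
transitivity (\sum_(J : {set E} | J \subset H) \sum_(f : {ffun 'I_dim -> {set E}})
   (if \bigcup_k f k \subset J then (-1) ^+ #|H :\: J| * \prod_k w (f k) else 0)).
  apply: eq_bigr => J JH.
  have -> q : q ^+ dim = \prod_(k < dim) q :> R by rewrite prodr_const card_ord.
  rewrite bigA_distr_big /= mulr_sumr big_mkcond /=; apply: eq_bigr => f _.
  congr (if _ then _ else _); apply/ffun_onP/bigcupsP => h k; first by move=> _; apply: h.
  exact: h.
rewrite exchange_big /= [RHS]big_mkcond /=; apply: eq_bigr => f _.
set U := \bigcup_k f k; rewrite -big_mkcondr /= -mulr_suml.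
suff -> : \sum_(J : {set E} | (J \subset H) && (U \subset J)) (-1) ^+ #|H :\: J| =
    (U == H)%:R :> R by case: (U == H); rewrite ?mul1r ?mul0r.
case: (boolP (U \subset H)) => UH; last first.
  rewrite big_pred0; first by case: eqP UH => // ->; rewrite subxx.
  by move=> J; apply: contraNF UH => /andP[JH UJ]; exact: subset_trans JH.
(* The alternating sum is the expansion of a product over [H] whose factor is [1] on [U] and [1 - 1]
   off [U]. *)
have := prod_addr_subsets H (fun=> 1) (fun e => if e \in U then 0 else -1).
rewrite [LHS](eq_bigr (fun e => (e \in U)%:R)); last first.
  by move=> e _; case: ifP; rewrite ?addr0 ?subrr.
rewrite (_ : \prod_(e in H) _ = (U == H)%:R); last first.
  case: eqP => [->|/eqP UnH]; first by apply: big1 => e ->.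
  have : ~~ (H \subset U) by apply: contra UnH => HU; rewrite eqEsubset UH HU.
  by move=> /subsetPn[e eH eU]; rewrite (bigD1 e) //= (negbTE eU) mul0r.
move=> ->; rewrite big_mkcondr /=; apply: eq_bigr => J JH.
rewrite big1_eq mul1r; case: ifP => [UJ|/negbT/subsetPn[e eU eJ]].
  rewrite -prodr_const; apply: eq_bigr => e; rewrite inE => /andP[eJ eH].
  by case: ifP => // eU; rewrite (fintype.subsetP UJ) in eJ.
by rewrite (bigD1 e) ?inE ?eJ ?(fintype.subsetP UH) //= eU mul0r.
Qed.

(** As [v] is subadditive and [b >= 1], the factor [b ^+ v H] can be distributed over the members of
    the tuple. Relaxing the union condition to inclusion in [H] lets the sum factor over
    coordinates. *)
Lemma norm_cover_sum_le (w : {set E} -> R) (v : {set E} -> nat) (b : R) H :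
  1 <= b -> (forall f : {ffun 'I_dim -> {set E}}, (v (\bigcup_k f k) <= \sum_k v (f k))%N) ->
  b ^+ v H * `|\sum_(f : {ffun 'I_dim -> {set E}} | \bigcup_k f k == H) \prod_k w (f k)|
  <= (\sum_(A : {set E} | A \subset H) `|w A| * b ^+ v A) ^+ dim.
Proof.
move=> b1 hv; have b0 : 0 <= b by apply: le_trans b1.
have -> q : q ^+ dim = \prod_(k < dim) q :> R by rewrite prodr_const card_ord.
rewrite bigA_distr_big /=.
apply: (le_trans (ler_wpM2l (exprn_ge0 _ b0) (ler_norm_sum _ _ _))).
rewrite mulr_sumr big_mkcond [X in _ <= X]big_mkcond /=.
apply: ler_sum => f _.
have nn : 0 <= \prod_k (`|w (f k)| * b ^+ v (f k)).
  by apply: prodr_ge0 => k _; rewrite mulr_ge0 // exprn_ge0.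
case: ifP => [/eqP fH|_]; last by case: ifP.
rewrite ifT; last first.
  by apply/ffun_onP => k; rewrite -fH; exact: (bigcup_sup k).
rewrite normr_prod big_split /= mulrC ler_wpM2l ?prodr_ge0 //.
rewrite prodrXr -fH; apply: ler_weXn2l => //; exact: hv.
Qed.

End SubsetSums.

(** * Counting edge sets by the vertices they cover *)

Section CountEdgeSets.
Import mathcomp.boot.fintype mathcomp.boot.finset.
Variables (R : realFieldType) (n : nat).
Implicit Types (A H : {set edge n}) (t : R).

Lemma card_covered_bigcup (dim : nat) (f : {ffun 'I_dim -> {set edge n}}) :
  (#|covered (\bigcup_k f k)| <= \sum_k #|covered (f k)|)%N.
Proof.
rewrite covered_bigcup; elim/big_rec2: _ => [|k m B _ h]; first by rewrite cards0.
by apply: (leq_trans (leq_card_setU _ _)); rewrite leq_add2l.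
Qed.

(** Group by the covered set [J]: [H] has at most [r * #|J|] edges inside [J], hence at most
    [2 ^ (r * #|J|)] subsets cover exactly [J]. *)
Lemma sum_subgraphs_le H r t : 0 <= t -> (#|H| <= r * r)%N ->
  \sum_(A : {set edge n} | (A \subset H) && (A != set0)) t ^+ #|covered A| <=
  \sum_(J : {set 'I_n} | (J \subset covered H) && (J != set0)) (2 ^+ r * t) ^+ #|J|.
Proof.
move=> t0 Hr; rewrite (partition_big (@covered n) (fun J => (J \subset covered H) && (J != set0))) /=; last first.
  by move=> A /andP[AH A0]; rewrite coveredS // covered_eq0.
apply: ler_sum => J /andP[JH J0].
rewrite (eq_bigr (fun=> t ^+ #|J|)); last by move=> A /andP[_ /eqP ->].
rewrite sumr_const -[X in X <= _]mulr_natl exprMn ler_wpM2r ?exprn_ge0 //.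
rewrite -exprM -natrX ler_nat.
apply: (@leq_trans #|powerset [set e in H | val e \subset J]|).
  apply: subset_leq_card; apply/fintype.subsetP => A; rewrite !inE => /andP[/andP[AH _] /eqP vA].
  apply/fintype.subsetP => e eA; rewrite inE (fintype.subsetP AH) //= -vA; exact: sub_covered.
rewrite card_powerset leq_exp2l //; apply: card_le_mul.
  by apply: leq_trans Hr; apply: subset_leq_card; apply/fintype.subsetP => e; rewrite inE => /andP[].
by apply: leq_trans (bin2_le_sqr _); apply: card_edgesin => e; rewrite inE => /andP[].
Qed.

(** Group by the covered set [J], of size at most [2 r^2]. At most [r * #|J|] edges are chosen among
    at most [4 r^4] pairs, which leaves [(4 r^4 + 1) ^ (r * #|J|)] choices. *)
Lemma sum_small_graphs_le r t : 0 <= t -> (0 < r)%N ->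
  \sum_(H : {set edge n} | (#|H| <= r * r)%N && (H != set0)) t ^+ #|covered H| <=
  \sum_(J : {set 'I_n} | J != set0) ((4 * r ^ 4).+1 ^ r)%N%:R ^+ #|J| * t ^+ #|J|.
Proof.
move=> t0 r0; rewrite (partition_big (@covered n) (fun J => (J != set0) && (#|J| <= 2 * (r * r))%N)) /=; last first.
  move=> H /andP[Hr H0]; rewrite covered_eq0 H0 /=; apply: leq_trans (card_covered_le _) _.
  by rewrite leq_mul2l.
rewrite big_mkcondr /=; apply: ler_sum => J J0.
case: ifP => hJ; last by rewrite mulr_ge0 // exprn_ge0.
rewrite (eq_bigr (fun=> t ^+ #|J|)); last by move=> A /andP[_ /eqP ->].
rewrite sumr_const -[X in X <= _]mulr_natl ler_wpM2r ?exprn_ge0 //.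
rewrite -natrX ler_nat -expnM.
set U := [set e : edge n | val e \subset J].
have cU : (#|U| <= #|J| * #|J|)%N.
  by apply: leq_trans (bin2_le_sqr _); apply: card_edgesin => e; rewrite inE.
apply: (@leq_trans #|[set H : {set edge n} | (H \subset U) && (#|H| <= r * #|J|)%N]|).
  apply: subset_leq_card; apply/fintype.subsetP => A; rewrite !inE => /andP[/andP[Ar _] /eqP vA].
  have AU : A \subset U.
    by apply/fintype.subsetP => e eA; rewrite inE -vA; exact: sub_covered.
  rewrite AU /=; apply: card_le_mul => //; apply: leq_trans cU; exact: subset_leq_card.
apply: (leq_trans (card_small_subsets _ _)); rewrite leq_exp2r; last first.
  by rewrite muln_gt0 r0 card_gt0.
rewrite ltnS; apply: (leq_trans cU); move: hJ; move: #|J| => j; clear => hJ.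
apply: (leq_trans (leq_mul hJ hJ)).
by rewrite !expnS expn0; apply: eq_leq; ring.
Qed.

End CountEdgeSets.

(** * All coordinates together: normalised Fourier coefficients of the grid model *)

Section AllCoordinates.
Import mathcomp.boot.fintype mathcomp.boot.finset.
Variables (R : realFieldType) (Z : finZmodType) (S : {set Z}) (n dim : nat).
Implicit Types (A H : {set edge n}) (e : edge n) (y : {ffun 'I_dim -> {ffun 'I_n -> Z}}).
Local Notation dens := (dens R S).

Definition mean (phi : {ffun 'I_dim -> {ffun 'I_n -> Z}} -> R) : R :=
  ((#|Z|%:R ^+ n) ^+ dim)^-1 * \sum_y phi y.
Definition grid_graph y : {set edge n} := [set e | [forall k, ~~ far S e (y k)]].
Definition grid_prob (G : {set edge n}) : R := mean (fun y => (grid_graph y == G)%:R).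
Definition grid_edge_prob : R := (1 - dens) ^+ dim.
(** Each factor is the edge indicator divided by [grid_edge_prob], minus one; this is the Fourier
    coefficient of the grid graph normalised by [grid_edge_prob ^+ #|H|]. *)
Definition Psi H : R := mean (fun y => \prod_(e in H) (\prod_k (1 + edge_weight R S e (y k)) - 1)).

Lemma eq_mean phi psi : phi =1 psi -> mean phi = mean psi.
Proof. by move=> h; rewrite /mean; congr (_ * _); apply: eq_bigr. Qed.

Lemma meanZ c phi : mean (fun y => c * phi y) = c * mean phi.
Proof. by rewrite /mean -mulr_sumr mulrCA. Qed.

Lemma meanD phi psi : mean (fun y => phi y + psi y) = mean phi + mean psi.
Proof. by rewrite /mean big_split mulrDr. Qed.

Lemma mean_sum (I : finType) (P : pred I) (F : I -> {ffun 'I_dim -> {ffun 'I_n -> Z}} -> R) :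
  mean (fun y => \sum_(i | P i) F i y) = \sum_(i | P i) mean (F i).
Proof. by rewrite /mean exchange_big mulr_sumr. Qed.

Lemma ler_mean phi psi : (forall y, phi y <= psi y) -> mean phi <= mean psi.
Proof.
move=> h; rewrite ler_pM2l ?ler_sum // invr_gt0 !exprn_gt0 //; exact: cardZ_gt0.
Qed.

Lemma mean_prod (phi : 'I_dim -> {ffun 'I_n -> Z} -> R) :
  mean (fun y => \prod_k phi k (y k)) = \prod_k avg (phi k).
Proof.
rewrite /mean -bigA_distr_bigA /= /avg big_split /=; congr (_ * _).
by rewrite prodr_const card_ord exprVn.
Qed.

Lemma mean_coord (k : 'I_dim) (phi : {ffun 'I_n -> Z} -> R) :
  mean (fun y => phi (y k)) = avg phi.
Proof.
rewrite (eq_mean (psi := fun y => \prod_j (if j == k then phi (y j) else 1))); last first.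
  by move=> y; rewrite -big_mkcond big_pred1_eq.
rewrite (mean_prod (fun j x => if j == k then phi x else 1)) (bigD1 k) //= eqxx.
rewrite big1 ?mulr1 // => j /negbTE ->; exact: avg_cst.
Qed.

Lemma mean_cst c : mean (fun=> c) = c.
Proof.
rewrite -[in LHS](mulr1 c) meanZ (eq_mean (psi := fun y => \prod_(k < dim) 1)); last first.
  by move=> y; rewrite big1_eq.
by rewrite (mean_prod (fun k x => 1)) big1 ?mulr1 // => k _; rewrite avg_cst.
Qed.

Lemma sum_grid_prob (phi : {set edge n} -> R) :
  \sum_G grid_prob G * phi G = mean (fun y => phi (grid_graph y)).
Proof.
rewrite (eq_mean (psi := fun y => \sum_(G : {set edge n}) phi G * (grid_graph y == G)%:R)).
  by rewrite mean_sum; apply: eq_bigr => G _; rewrite meanZ mulrC.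
move=> y; rewrite (bigD1 (grid_graph y)) //= eqxx mulr1 big1 ?addr0 // => G GG.
by rewrite eq_sym (negbTE GG) mulr0.
Qed.

Hypothesis symS : forall s, (- s \in S) = (s \in S).
Hypothesis S0 : 0 \notin S.

Lemma sum_grid_prob_edge e : \sum_G grid_prob G * (e \in G)%:R = grid_edge_prob.
Proof.
rewrite (sum_grid_prob (fun G => (e \in G)%:R)).
rewrite (eq_mean (psi := fun y => \prod_k (1 - (far S e (y k))%:R))); last first.
  move=> y; rewrite inE; case: forallP => [h|/forallP/forallPn[k]]; last first.
    by rewrite negbK => h; rewrite (bigD1 k) //= h subrr mul0r.
  by rewrite big1 // => k _; rewrite (negbTE (h k)) subr0.
rewrite (mean_prod (fun k x => 1 - (far S e x)%:R)) /grid_edge_prob.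
rewrite (eq_bigr (fun=> 1 - dens)) ?prodr_const ?card_ord // => k _.
have /card_gt0P[a ae] : (0 < #|val e|)%N by rewrite (eqP (valP e)).
have := avg_far symS S0 (phi := fun=> 1 : R) (fun b => 1 - b%:R) ae (fun _ _ => erefl).
rewrite avg_cst mul1r /= mulr1n mulr0n subrr subr0 mulr0 add0r mulr1 => <-.
by apply: eq_avg => x; rewrite mul1r.
Qed.

Hypothesis dens_le : dens <= 3^-1.

Lemma sum_grid_prob_fourier H :
  \sum_G grid_prob G * \prod_(e in H) ((e \in G)%:R - grid_edge_prob) = grid_edge_prob ^+ #|H| * Psi H.
Proof.
rewrite (sum_grid_prob (fun G => \prod_(e in H) ((e \in G)%:R - grid_edge_prob))) -meanZ.
apply: eq_mean => y; rewrite -prodr_const -big_split /=; apply: eq_bigr => e _.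
rewrite mulrBr mulr1; congr (_ - _).
have -> : grid_edge_prob = \prod_(k < dim) (1 - dens) by rewrite prodr_const card_ord.
have d0 := dens_ge0 R S; have d1 := dens_le.
rewrite -big_split /= (eq_bigr (fun k => 1 - (far S e (y k))%:R)); last first.
  by move=> k _; rewrite /edge_weight; field; apply/eqP; lra.
rewrite inE; case: forallP => [h|/forallP/forallPn[k]].
  by rewrite big1 // => k _; rewrite (negbTE (h k)) subr0.
by rewrite negbK => h; rewrite (bigD1 k) //= h subrr mul0r.
Qed.

(** Expanding the differences gives an alternating sum over [J]. For fixed [J] the coordinates are
    independent, so the term is a [dim]-th power of the sum of [W A] over subsets [A] of [J], and
    inclusion-exclusion applies. *)
Lemma Psi_cover H : Psi H =
  \sum_(f : {ffun 'I_dim -> {set edge n}} | \bigcup_k f k == H) \prod_k W R S (f k).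
Proof.
rewrite -alternating_cover_sum /Psi.
rewrite (eq_mean (psi := fun y => \sum_(J : {set edge n} | J \subset H)
   (-1) ^+ #|H :\: J| * \prod_k \prod_(e in J) (1 + edge_weight R S e (y k)))); last first.
  move=> y; rewrite (prod_addr_subsets H _ (fun=> -1)); apply: eq_bigr => J JH.
  by rewrite prodr_const mulrC exchange_big.
rewrite mean_sum; apply: eq_bigr => J JH; rewrite meanZ; congr (_ * _).
rewrite (mean_prod (fun k x => \prod_(e in J) (1 + edge_weight R S e x))) prodr_const card_ord.
congr (_ ^+ _).
rewrite (eq_avg (psi := fun x => \sum_(A : {set edge n} | A \subset J) \prod_(e in A) edge_weight R S e x)).
  by rewrite avg_sum.
move=> x; rewrite (eq_bigr (fun e => edge_weight R S e x + 1)); last by move=> e _; rewrite addrC.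
rewrite prod_addr_subsets; apply: eq_bigr => A _; by rewrite big1_eq mulr1.
Qed.

(** Unions of leafless sets are leafless, so each tuple covering [H] contains a set on which [W]
    vanishes. *)
Lemma Psi_leaf H : ~~ leafless H -> Psi H = 0.
Proof.
move=> lH; rewrite Psi_cover big1 // => f /eqP fH.
case: (boolP [forall k, leafless (f k)]) => [/forallP h|/forallPn[k hk]].
  by move: lH; rewrite -fH leafless_bigcup.
by rewrite (bigD1 k) //= (W_leaf symS S0 dens_le hk) mul0r.
Qed.

Hypothesis sumfree : forall a b c, a \in S -> b \in S -> c \in S -> a + b + c != 0.

(** The left side is at most [(1 + q) ^+ dim], where the 1 comes from the empty set and [q] from the
    nonempty ones. The first smallness hypothesis controls the sum over vertex sets in [q]; the
    second gives [dim * q <= 1/2]. *)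
Lemma Psi_le H (s b : R) (r : nat) : 0 <= s -> s ^+ 2 = 2 * dens -> 1 <= b ->
  (#|H| <= r * r)%N ->
  (2 * (r * r))%:R * (2 ^+ r * (s * b)) <= 2^-1 ->
  dim%:R * (2 * dens * (2 * ((2 * (r * r))%:R * (2 ^+ r * (s * b))))) <= 2^-1 ->
  b ^+ #|covered H| * `|Psi H| <= 2.
Proof.
move=> s0 s2 b1 Hr hz hd; have b0 : 0 <= b by apply: le_trans b1.
have d0 := dens_ge0 R S.
set z := 2 ^+ r * (s * b) in hz hd.
have z0 : 0 <= z by rewrite !mulr_ge0 // exprn_ge0.
have vH : (#|covered H| <= 2 * (r * r))%N.
  by apply: (leq_trans (card_covered_le _)); rewrite leq_mul2l.
set V := (2 * (r * r))%:R in hz hd.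
have V0 : 0 <= V by rewrite ler0n.
have vz : #|covered H|%:R * z <= V * z by rewrite ler_wpM2r // ler_nat.
rewrite Psi_cover.
have hcov := @norm_cover_sum_le R _ dim (@W R Z S n) (fun A => #|covered A|) b H b1 (@card_covered_bigcup n dim).
apply: (le_trans hcov) => {hcov}.
rewrite (bigD1 set0) ?sub0set //= W_set0 covered0 cards0 expr0 mulr1 normr1.
set q := \sum_(A | _) _.
have q0 : 0 <= q by apply: sumr_ge0 => A _; rewrite mulr_ge0 // exprn_ge0.
have qle : q <= 2 * dens * (2 * (V * z)).
  apply: (@le_trans _ _ (2 * dens * (2 * (#|covered H|%:R * z)))); last first.
    by apply: ler_wpM2l; [rewrite mulr_ge0 | apply: ler_wpM2l].
  (* The extra exponent 2 in the bound on [W A] yields the prefactor [2 * dens], which later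
     compensates the number of coordinates. *)
  apply: (@le_trans _ _ (2 * dens * \sum_(A : {set edge n} | (A \subset H) && (A != set0)) (s * b) ^+ #|covered A|)).
    rewrite mulr_sumr; apply: ler_sum => A /andP[AH A0].
    case: (boolP (leafless A)) => lA; last first.
      by rewrite (W_leaf symS S0 dens_le lA) normr0 mul0r; apply: mulr_ge0; [apply: mulr_ge0 | apply: exprn_ge0; apply: mulr_ge0].
    apply: (le_trans (ler_wpM2r (exprn_ge0 _ b0) (norm_W_le symS S0 dens_le sumfree s0 s2 lA A0))).
    by rewrite exprD s2 exprMn [X in X <= _]mulrAC [X in X <= _]mulrC.
  apply: ler_wpM2l; first by rewrite mulr_ge0.
  apply: (le_trans (sum_subgraphs_le (mulr_ge0 s0 b0) Hr)).
  by apply: sum_nonempty_subset_pow => //; apply: le_trans hz.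
have hq : dim%:R * q <= 2^-1 by apply: le_trans hd; rewrite ler_wpM2l.
apply: (le_trans (bernoulli_upper q0 hq)); lra.
Qed.

End AllCoordinates.

(** * Fourier analysis of product Bernoulli measures *)

Lemma weighted_cauchy_schwarz (R : realFieldType) (I : finType) (P : pred I) (c m s : I -> R) :
  (forall i, P i -> 0 < s i) ->
  (\sum_(i | P i) c i * m i) ^+ 2 <=
  (\sum_(i | P i) c i ^+ 2 * s i) * (\sum_(i | P i) m i ^+ 2 / s i).
Proof.
move=> s0; set X := \sum_(i | P i) c i * m i; set A := \sum_(i | P i) c i ^+ 2 * s i.
set B := \sum_(i | P i) m i ^+ 2 / s i.
have term0 i : P i -> 0 <= m i ^+ 2 / s i.
  by move=> Pi; rewrite divr_ge0 ?sqr_ge0 // ltW // s0.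
have B0 : 0 <= B by exact: sumr_ge0.
(* The sum of [s i * (B * c i - X * (m i / s i)) ^+ 2] is nonnegative, and it equals this
   product. *)
have key : 0 <= B * (B * A - X ^+ 2).
  have sq b x : b ^+ 2 * A + (- 2 * b * x) * X + x ^+ 2 * B =
      \sum_(i | P i) s i * (b * c i - x * (m i / s i)) ^+ 2.
    rewrite /A /X /B !mulr_sumr -!big_split /=; apply: eq_bigr => i Pi.
    by field; rewrite gt_eqF // s0.
  have -> : B * (B * A - X ^+ 2) = B ^+ 2 * A + (- 2 * B * X) * X + X ^+ 2 * B by ring.
  rewrite sq.
  by apply: sumr_ge0 => i Pi; rewrite mulr_ge0 ?sqr_ge0 // ltW // s0.
case: (ltgtP B 0) => [|Bp|BZ]; first by rewrite ltNge B0.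
  by move: key; rewrite pmulr_rge0 // subr_ge0 mulrC.
(* For [B = 0] no division is possible, but then every [m i] vanishes and so does [X]. *)
have m0 i : P i -> m i = 0.
  move=> Pi; have /eqP : \sum_(i | P i) m i ^+ 2 / s i = 0 by exact: BZ.
  rewrite psumr_eq0 // => /allP /(_ i (mem_index_enum i)); rewrite Pi /= => /eqP/eqP.
  by rewrite mulf_eq0 invr_eq0 (gt_eqF (s0 _ Pi)) orbF sqrf_eq0 => /eqP.
rewrite BZ mulr0 /X big1 ?expr0n // => i Pi; by rewrite m0 ?mulr0.
Qed.

Section Fourier.
Import mathcomp.boot.fintype mathcomp.boot.finset.
Variables (R : realFieldType) (E : finType) (p : R).
Hypotheses (p0 : 0 < p) (p1 : p < 1).
Implicit Types (G H K : {set E}) (h w : {set E} -> R).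

(** The formula of [er_prob], over an arbitrary finite type of edges. *)
Definition ber G : R := p ^+ #|G| * (1 - p) ^+ (#|E| - #|G|).
Definition chi H G : R := \prod_(e in H) ((e \in G)%:R - p).
Let sig : R := p * (1 - p).

Lemma ber_prod G : ber G = \prod_e (if e \in G then p else 1 - p).
Proof.
rewrite (bigID (mem G)) /= (eq_bigr (fun=> p)); last by move=> e ->.
rewrite [X in _ * X](eq_bigr (fun=> 1 - p)); last by move=> e /negbTE ->.
rewrite !prodr_const; congr (_ * _ ^+ _).
by rewrite -(cardC G) addKn; apply: eq_card => i; rewrite !inE.
Qed.

Lemma sum_ber_prod (g : E -> bool -> R) :
  \sum_G ber G * \prod_e g e (e \in G) = \prod_e (p * g e true + (1 - p) * g e false).
Proof.
rewrite bigA_distr; apply: eq_bigr => G _; rewrite ber_prod -big_split /=.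
by apply: eq_bigr => e _; case: (e \in G).
Qed.

Lemma chiE H G : chi H G = \prod_e (if e \in H then (e \in G)%:R - p else 1).
Proof. by rewrite /chi big_mkcond. Qed.

Lemma sum_ber_chi H : \sum_G ber G * chi H G = (H == set0)%:R.
Proof.
under eq_bigr do rewrite chiE.
rewrite (sum_ber_prod (fun e b => if e \in H then b%:R - p else 1)).
case: eqP => [->|/eqP/set0Pn[e eH]].
  by apply: big1 => e _; rewrite inE; ring.
by rewrite (bigD1 e) //= eH /= mulr1n mulr0n; rewrite [X in X * _](_ : _ = 0) ?mul0r //; ring.
Qed.

(** An element lying in exactly one of [H] and [K] contributes a factor of mean zero; one lying in
    both contributes the Bernoulli variance. *)
Lemma sum_ber_chi2 H K :
  \sum_G ber G * (chi H G * chi K G) = (H == K)%:R * sig ^+ #|H|.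
Proof.
under eq_bigr do rewrite !chiE -big_split /=.
rewrite (sum_ber_prod (fun e b => (if e \in H then b%:R - p else 1) * (if e \in K then b%:R - p else 1))).
case: eqP => [->|HK].
  rewrite mul1r -prodr_const [RHS]big_mkcond /=; apply: eq_bigr => e _.
  by case: ifP => _; rewrite /= ?mulr1n ?mulr0n /sig; ring.
have [e He] : exists e, (e \in H) != (e \in K).
  apply/existsP; apply: contra_notT HK => /existsPn h; apply/setP => e.
  by have := h e; rewrite negbK => /eqP.
rewrite mul0r (bigD1 e) //=; move: He; case: (e \in H); case: (e \in K) => //= _;
  rewrite /= ?mulr1n ?mulr0n; rewrite [X in X * _](_ : _ = 0) ?mul0r //; ring.
Qed.

Lemma monomial_chi K G :
  \prod_(e in K) (e \in G)%:R = \sum_(H : {set E} | H \subset K) p ^+ #|K :\: H| * chi H G.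
Proof.
rewrite (eq_bigr (fun e => ((e \in G)%:R - p) + p)); last by move=> e _; rewrite subrK.
rewrite prod_addr_subsets; apply: eq_bigr => H _; by rewrite prodr_const mulrC.
Qed.

Lemma chi_set0 G : chi set0 G = 1.
Proof. by rewrite /chi big_set0. Qed.

(** The constant term of [h] is its Bernoulli mean, and by orthogonality the other squared
    coefficients, weighted by [sig ^+ #|H|], add up to its variance. Cauchy-Schwarz with these
    weights finishes. *)
Lemma low_degree_bound w h (D : nat) (c : {set E} -> R) :
  \sum_G w G = 1 ->
  (forall G, h G = \sum_(H : {set E} | (#|H| <= D)%N) c H * chi H G) ->
  (\sum_G w G * h G - \sum_G ber G * h G) ^+ 2 <=
  (\sum_G ber G * h G ^+ 2 - (\sum_G ber G * h G) ^+ 2) *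
  (\sum_(H : {set E} | (#|H| <= D)%N && (H != set0)) (\sum_G w G * chi H G) ^+ 2 / sig ^+ #|H|).
Proof.
move=> w1 hE.
(* The weight [v] is arbitrary because it is taken below as [w], as [ber], as [ber] times [h] and as
   [ber] times a character. *)
have lin v : \sum_G v G * h G = \sum_(H : {set E} | (#|H| <= D)%N) c H * \sum_G v G * chi H G.
  under eq_bigr do rewrite hE mulr_sumr.
  rewrite exchange_big; apply: eq_bigr => H _; rewrite mulr_sumr.
  by apply: eq_bigr => G _; rewrite mulrCA.
have Eber : \sum_G ber G * h G = c set0.
  rewrite lin (bigD1 set0) ?cards0 //= sum_ber_chi eqxx mulr1.
  by rewrite big1 ?addr0 // => H /andP[_ H0]; rewrite sum_ber_chi (negbTE H0) mulr0.
have Ew : \sum_G w G * h G - c set0 =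
    \sum_(H : {set E} | (#|H| <= D)%N && (H != set0)) c H * \sum_G w G * chi H G.
  rewrite lin (bigD1 set0) ?cards0 //=.
  under eq_bigr do rewrite chi_set0 mulr1.
  by rewrite w1 mulr1 [_ + _ - _]addrC addKr.
have E2 : \sum_G ber G * h G ^+ 2 = \sum_(H : {set E} | (#|H| <= D)%N) c H ^+ 2 * sig ^+ #|H|.
  rewrite (eq_bigr (fun G => ber G * h G * h G)); last by move=> G _; rewrite expr2 mulrA.
  rewrite (lin (fun G => ber G * h G)); apply: eq_bigr => H HD.
  rewrite (eq_bigr (fun G => (ber G * chi H G) * h G)); last by move=> G _; rewrite mulrAC.
  rewrite (lin (fun G => ber G * chi H G)) (bigD1 H) //=.
  under eq_bigr do rewrite -mulrA.
  rewrite sum_ber_chi2 eqxx mul1r big1 ?addr0; first by rewrite expr2 mulrA.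
  move=> K /andP[_ KH]; under eq_bigr do rewrite -mulrA.
  by rewrite sum_ber_chi2 eq_sym (negbTE KH) mul0r mulr0.
rewrite Eber Ew E2 [X in (X - _) * _](bigD1 set0) /= ?cards0 // expr0 mulr1 [_ + _ - _]addrC addKr.
apply: weighted_cauchy_schwarz => H _; rewrite exprn_gt0 // mulr_gt0 // subr_gt0.
exact: p1.
Qed.

Lemma variance_ge0 w h : (forall G, 0 <= w G) -> \sum_G w G = 1 ->
  0 <= \sum_G w G * h G ^+ 2 - (\sum_G w G * h G) ^+ 2.
Proof.
move=> w0 w1; set m := \sum_G w G * h G.
have -> : \sum_G w G * h G ^+ 2 - m ^+ 2 = \sum_G w G * (h G - m) ^+ 2.
  transitivity (\sum_G (w G * h G ^+ 2 + (- 2 * m) * (w G * h G) + m ^+ 2 * w G)).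
    by rewrite !big_split /= -!mulr_sumr -/m w1; ring.
  by apply: eq_bigr => G _; ring.
by apply: sumr_ge0 => G _; rewrite mulr_ge0 // sqr_ge0.
Qed.

End Fourier.

(** * The cyclic grid: far residues, and circular distances after rounding *)

Section FarInterval.
Import mathcomp.boot.fintype mathcomp.boot.finset.
Variables (m c0 : nat).

(** The residues modulo [m.+1] at circular distance more than [c0] from [0]. *)
Definition farset : {set 'I_m.+1} := [set c : 'I_m.+1 | (c0 < c)%N && (c + c0 < m.+1)%N].
(* The cells at which rounding to the grid may change the adjacency. *)
Definition bdset : {set 'I_m.+1} :=
  [set c : 'I_m.+1 | [|| c == 0 :> nat, (c0 <= c.+1 <= c0.+2)%N
                      | (c0 <= (m.+1 - c).+1 <= c0.+2)%N]].

Lemma val_oppI (c : 'I_m.+1) : c != 0 :> nat -> (- c)%R = (m.+1 - c)%N :> nat.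
Proof. by move=> c_n0; rewrite /= modn_small //; have := ltn_ord c; lia. Qed.

Lemma val_subI (a b : 'I_m.+1) :
  (a - b)%R = (if b <= a then a - b else a + m.+1 - b)%N :> nat.
Proof.
rewrite /=; have := ltn_ord a; have := ltn_ord b.
move: (nat_of_ord a) (nat_of_ord b) => {}a {}b bM aM; case: leqP => ab.
  case: (posnP b) => [->|b0]; first by rewrite subn0 modnn addn0 subn0 modn_small.
  rewrite (modn_small (m := m.+1 - b)); last lia.
  have -> : (a + (m.+1 - b) = a - b + m.+1)%N by lia.
  by rewrite modnDr modn_small //; lia.
rewrite (modn_small (m := m.+1 - b)); last lia.
by rewrite addnBA 1?ltnW // modn_small //; lia.
Qed.

Lemma farset_sym c : (- c \in farset) = (c \in farset).
Proof.
rewrite !inE; case: (eqVneq (c : nat) 0%N) => [c_0|c_n0].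
  by have -> : c = 0 by [apply: val_inj]; rewrite oppr0.
have -> := val_oppI c_n0; have := ltn_ord c; move: (c : nat) => k kM.
by apply/andP/andP => -[? ?]; split; lia.
Qed.

Lemma farset0 : 0 \notin farset.
Proof. by rewrite inE. Qed.

Lemma card_farset : (m - 2 * c0 <= #|farset|)%N.
Proof.
have emb (i : 'I_(m - 2 * c0)) : (c0.+1 + i < m.+1)%N by have := ltn_ord i; lia.
pose f i := Ordinal (emb i).
have f_inj : injective f.
  by move=> i j /(congr1 val) /= ij; apply: val_inj => /=; lia.
rewrite -[X in (X <= _)%N]card_ord -(card_imset _ f_inj); apply: subset_leq_card.
apply/subsetP => c /imsetP[i _ ->]; rewrite inE /=.
by have := ltn_ord i; lia.
Qed.

(** The bound does not depend on [m], so a uniform residue is in [bdset] with probability tending to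
    zero as the grid is refined. *)
Lemma card_bdset : (#|bdset| <= 7)%N.
Proof.
pose l := [:: 0; c0.-1; c0; c0.+1; (m.+1 - c0.-1); (m.+1 - c0); (m.+1 - c0.+1)]%N.
rewrite cardE -(size_map (@nat_of_ord _)) (_ : 7 = size l)%N //; apply: uniq_leq_size.
  by rewrite map_inj_uniq ?enum_uniq //; exact: ord_inj.
move=> k /mapP[c]; rewrite mem_enum inE => hc ->.
have := ltn_ord c; move: hc; move: (c : nat) => {}c.
rewrite /l !inE; lia.
Qed.

(** Density at most [1/3] forces [3 * c0 >= m]; three elements between [c0 + 1] and [m - c0] then
    have a sum strictly between [m.+1] and twice [m.+1], so not a multiple of it. *)
Lemma farset_sumfree (R : realFieldType) : dens R farset <= 3^-1 ->
  forall a b c, a \in farset -> b \in farset -> c \in farset -> a + b + c != 0.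
Proof.
rewrite /dens card_ord ler_pdivrMr ?ltr0n // => h.
have {}h : (3 * #|farset| <= m.+1)%N.
  by rewrite -(ler_nat R) natrM; lra.
have := card_farset => h2 a b c.
rewrite !inE => /andP[a1 a2] /andP[b1 b2] /andP[c1 c2]; apply/eqP => /(congr1 val) /=.
rewrite modnDml => /eqP; have := ltn_ord a; have := ltn_ord b; have := ltn_ord c.
rewrite -/(dvdn _ _) => cM bM aM /dvdnP[k Ek].
have k3 : (k < 3)%N by rewrite -(ltn_pmul2r (ltn0Sn m)) -Ek; lia.
by case: k k3 Ek => [|[|[|]]] //; lia.
Qed.

End FarInterval.

Lemma circ_distE (R : realType) (x y : R) (k : int) :
  0 <= x - y - 2 * k%:~R < 2 -> circ_dist x y =
  Num.min (x - y - 2 * k%:~R) (2 - (x - y - 2 * k%:~R)).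
Proof.
move=> /andP[h0 h2]; rewrite /circ_dist; have -> // : Num.floor ((x - y) / 2) = k.
apply: floor_def; rewrite intrD; apply/andP; split; lra.
Qed.

(** In units of one cell, rounding moves a difference by less than 1, and the threshold lies in
    [[c0, c0 + 1)]. The comparison can change only for residues within 1 of [c0] or of [m.+1 - c0],
    which [bdset] contains. *)
Lemma circ_dist_grid (R : realType) (m : nat) (tau x x' : R) (a b : 'I_m.+1) :
  0 <= tau ->
  let c0 := Num.truncn (tau * m.+1%:R / 2) in
  2 * a%:R / m.+1%:R <= x < 2 * a.+1%:R / m.+1%:R ->
  2 * b%:R / m.+1%:R <= x' < 2 * b.+1%:R / m.+1%:R ->
  a - b \notin bdset m c0 ->
  (circ_dist x x' <= tau) = (a - b \notin farset m c0).
Proof.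
move=> tau0 c0 /andP[xa xa'] /andP[xb xb'] hbd.
set M : R := m.+1%:R; have M0 : 0 < M by rewrite ltr0n.
set kap := tau * M / 2; have kap0 : 0 <= kap by rewrite divr_ge0 ?mulr_ge0 // ltW.
have /andP[c0l c0r] : c0%:R <= kap < c0.+1%:R by exact: truncn_itv.
set c := a - b in hbd *; have cM := ltn_ord c; have aM := ltn_ord a; have bM := ltn_ord b.
(* The displacement measured in cells of length [2 / M]. *)
pose th := (x - x') * M / 2.
have thE : x - x' = 2 * th / M by rewrite /th; field; rewrite gt_eqF.
have [th1 th2] : a%:R - b%:R - 1 < th /\ th < a%:R - b%:R + 1.
  move: xa xa' xb xb'; rewrite !ler_pdivrMr // !ltr_pdivlMr // -!natr1 /th => *; split; nra.
have c_n0 : (c : nat) != 0%N by move: hbd; rewrite inE negb_or => /andP[].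
(* The integer [k] is 0 or -1 according to whether subtraction of the indices wraps around. *)
have [k [ck1 ck2]] : exists k : int, c%:R - 1 < th - M * k%:~R /\ th - M * k%:~R < c%:R + 1.
  rewrite (val_subI a b); case: leqP => ab.
    by exists 0; rewrite natrB //; split; lra.
  exists (-1); rewrite natrB; last by rewrite (leq_trans (ltnW bM)) // leq_addl.
  by rewrite natrD -/M; split; lra.
have rE : x - x' - 2 * k%:~R = 2 * (th - M * k%:~R) / M by rewrite thE; field; rewrite gt_eqF.
set rho := th - M * k%:~R in ck1 ck2 rE.
(* Excluding the residue [0] keeps [rho] strictly between [0] and [M], so [circ_distE] applies with
   this [k]. *)
have c1 : 1 <= c%:R :> R by rewrite ler1n lt0n.
have cM1 : c%:R + 1 <= M by rewrite /M natr1 ler_nat.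
rewrite (@circ_distE _ _ _ k); last first.
  by rewrite rE divr_ge0 ?(ltW M0) //= ?ltr_pdivrMr //; lra.
rewrite rE ge_min.
have -> : (2 * rho / M <= tau) = (rho <= kap).
  rewrite /kap ler_pdivrMr // ler_pdivlMr //; apply/idP/idP; lra.
have -> : (2 - 2 * rho / M <= tau) = (M - rho <= kap).
  have -> : 2 - 2 * rho / M = 2 * (M - rho) / M by field; rewrite gt_eqF.
  rewrite /kap ler_pdivrMr // ler_pdivlMr //; apply/idP/idP; lra.
move: hbd; rewrite !inE !negb_or => /and3P[_ h1 h2].
have -> : (rho <= kap) = (c <= c0)%N.
  case: (ltnP c.+1 c0) => [h|h].
    rewrite (ltnW (ltnW h)); apply/idP.
    have : c.+1%:R <= c0%:R :> R by rewrite ler_nat ltnW.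
    by rewrite -natr1; lra.
  have {}h : (c0.+2 <= c)%N by move: h1 h; clear; move: (nat_of_ord c) => {}c; lia.
  have : c0.+2%:R <= c%:R :> R by rewrite ler_nat.
  rewrite -!natr1 leqNgt (ltn_trans _ h) // => ?; apply/negbTE; rewrite -ltNge.
  by move: c0r; rewrite -natr1; lra.
have -> : (M - rho <= kap) = (m.+1 - c <= c0)%N.
  have Mc : M - c%:R = (m.+1 - c)%N%:R by rewrite natrB // ltnW.
  case: (ltnP (m.+1 - c).+1 c0) => [h|h].
    rewrite (ltnW (ltnW h)); apply/idP.
    have : (m.+1 - c).+1%:R <= c0%:R :> R by rewrite ler_nat ltnW.
    by rewrite -natr1 -Mc; lra.
  have {}h : (c0.+2 <= m.+1 - c)%N by move: h2 h; clear; move: (nat_of_ord c) => {}c; lia.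
  have : c0.+2%:R <= (m.+1 - c)%N%:R :> R by rewrite ler_nat.
  rewrite -!natr1 -Mc [X in _ = X]leqNgt (ltn_trans _ h) // => ?; apply/negbTE; rewrite -ltNge.
  by move: c0r; rewrite -natr1; lra.
by rewrite leq_subLR negb_and -!leqNgt.
Qed.

Local Open Scope classical_set_scope.

(** * The torus model as a limit of grid models *)

Section Discretization.
Context (R : realType) (d0 : measure_display) (T : measurableType d0).
Context (P : probability T R) (n dim : nat) (X : 'I_n -> 'I_dim -> T -> R) (tau : R).
Hypothesis iid : iid_unif_torus P X.
Hypothesis tau0 : 0 <= tau.

Lemma circ_dist_self (x : R) : circ_dist x x = 0.
Proof.
rewrite (@circ_distE _ _ _ 0); last by rewrite subrr mulr0 subr0 lexx /=.
by rewrite subrr mulr0 subr0 minElt; case: ifP; rewrite ?ltr0n // subr0 ltr0n.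
Qed.

Lemma linf_dist_leE (x y : 'I_dim -> R) :
  (linf_dist x y <= tau) = [forall k, circ_dist (x k) (y k) <= tau].
Proof.
apply/bigmax_leP/forallP => [[_ h] k|h]; first exact: h.
by split => // k _; exact: h.
Qed.

Lemma mem_rggP w (e : edge n) :
  reflect (forall i j k, i \in val e -> j \in val e -> circ_dist (X i k w) (X j k w) <= tau)
          (e \in rgg_graph X tau w).
Proof.
rewrite finset.in_set; apply: (iffP forall_inP) => [h i j k ie je|h i ie].
  by have /forall_inP/(_ j je) := h i ie; rewrite linf_dist_leE => /forallP.
by apply/forall_inP => j je; rewrite linf_dist_leE; apply/forallP => k; exact: h.
Qed.

Lemma measurable_circ_dist (f g : T -> R) :
  measurable_fun setT f -> measurable_fun setT g ->
  measurable_fun setT (fun w => circ_dist (f w) (g w)).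
Proof.
move=> mf mg; rewrite /circ_dist.
have mt : measurable_fun setT (fun w => f w - g w) by exact: measurable_funB.
have mr : measurable_fun setT (fun w => f w - g w - 2 * (Num.floor ((f w - g w) / 2))%:~R).
  apply: measurable_funB => //; apply: measurable_funM => //.
  have mfl : measurable_fun setT (fun x : R => (Num.floor x)%:~R : R).
    by apply: nondecreasing_measurable => // x y xy; rewrite ler_int; exact: le_floor.
  exact: (measurableT_comp mfl (measurable_funM mt (measurable_cst _))).
by apply: measurable_minr => //; apply: measurable_funB.
Qed.

Lemma measurable_mem_rgg (e : edge n) : measurable [set w | e \in rgg_graph X tau w].
Proof.
have [mX _] := iid.
rewrite (_ : [set _ | _] = \bigcap_(ijk in [set ijk : 'I_n * 'I_n * 'I_dim |
    (ijk.1.1 \in val e) /\ (ijk.1.2 \in val e)])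
   [set w | circ_dist (X ijk.1.1 ijk.2 w) (X ijk.1.2 ijk.2 w) <= tau]); last first.
  apply/seteqP; split => w /=.
    by move=> /mem_rggP h [[i j] k] /= [ie je]; exact: h.
  by move=> h; apply/mem_rggP => i j k ie je; exact: (h (i, j, k)).
apply: fin_bigcap_measurable => [|[[i j] k] _ /=]; first exact: finite_finset.
have := measurable_circ_dist (mX i k) (mX j k) measurableT (measurable_itv `]-oo, tau]%R).
rewrite setTI; congr (measurable _); apply/seteqP; split => w /=; by rewrite in_itv.
Qed.

Lemma measurable_rgg (G : graph n) : measurable [set w | rgg_graph X tau w = G].
Proof.
rewrite (_ : [set _ | _] = \bigcap_(e in [set: edge n])
   (if e \in G then [set w | e \in rgg_graph X tau w] else ~` [set w | e \in rgg_graph X tau w])).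
  apply: fin_bigcap_measurable => [|e _]; first exact: finite_finset.
  by case: ifP => _; [|apply: measurableC]; exact: measurable_mem_rgg.
apply/seteqP; split => w /=.
  by move=> <- e _; case: ifP => [//|/negbT/negP].
move=> h; apply/finset.setP => e; have := h e I; case: ifP => //= _.
by move/negP/negbTE.
Qed.

Lemma measure_finType_bigcup (Y : finType) (Q : pred Y) (F : Y -> set T) :
  (forall y, measurable (F y)) -> (forall y y' w, F y w -> F y' w -> y = y') ->
  P (\bigcup_(y in [set` Q]) F y) = (\sum_(y | Q y) P (F y))%E.
Proof.
move=> mF dF; rewrite measure_fin_bigcup //.
- by rewrite [RHS]bigfs ?index_enum_uniq // => y _; rewrite mem_index_enum.
- by move=> y y' _ _ [w [h h']]; exact: dF h h'.
Qed.

Lemma rgg_probE (G : graph n) : (rgg_prob P X tau G)%:E = P [set w | rgg_graph X tau w = G].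
Proof. by rewrite /rgg_prob fineK // fin_num_measure //; exact: measurable_rgg. Qed.

Lemma rgg_prob_ge0 (G : graph n) : 0 <= rgg_prob P X tau G.
Proof. by rewrite -lee_fin rgg_probE; exact: measure_ge0. Qed.

Lemma sum_rgg_prob_pred (Q : pred (graph n)) :
  (\sum_(G | Q G) rgg_prob P X tau G)%:E = P [set w | Q (rgg_graph X tau w)].
Proof.
rewrite -sumEFin (eq_bigr (fun G => P [set w | rgg_graph X tau w = G])); last first.
  by move=> G _; exact: rgg_probE.
rewrite -measure_finType_bigcup; last 2 first.
- exact: measurable_rgg.
- by move=> G G' w /= -> ->.
congr (P _); apply/seteqP; split => w /=; first by move=> [G QG /= ->].
by move=> Qw; exists (rgg_graph X tau w).
Qed.

Lemma sum_rgg_prob : \sum_G rgg_prob P X tau G = 1.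
Proof.
apply: EFin_inj; rewrite (sum_rgg_prob_pred predT) -(probability_setT P).
by congr (P _); apply/seteqP; split.
Qed.

Section Grid.
Variable m : nat.
Let M : R := m.+1%:R.
Local Notation conf := {ffun 'I_dim -> {ffun 'I_n -> 'I_m.+1}}.
Let c0 := Num.truncn (tau * m.+1%:R / 2).

Definition cell (a : 'I_m.+1) : set R := [set` `[2 * a%:R / M, 2 * a.+1%:R / M[%R].

Definition cells (y : conf) : set T :=
  \bigcap_(i in [set: 'I_n]) \bigcap_(k in [set: 'I_dim]) (X i k @^-1` cell (y k i)).

Lemma measurable_cells y : measurable (cells y).
Proof.
have [mX _] := iid.
apply: fin_bigcap_measurable => [|i _]; first exact: finite_finset.
apply: fin_bigcap_measurable => [|k _]; first exact: finite_finset.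
by rewrite -[X in measurable X]setTI; apply: mX => //; exact: measurable_itv.
Qed.

Lemma cell_inj a b x : cell a x -> cell b x -> a = b.
Proof.
have M0 : 0 < M by rewrite ltr0n.
rewrite /cell /= !in_itv /= !ler_pdivrMr // !ltr_pdivlMr // => /andP[a1 a2] /andP[b1 b2].
apply: ord_inj; apply/eqP; rewrite eqn_leq; apply/andP; split; rewrite -ltnS -(ltr_nat R); lra.
Qed.

Lemma cells_inj y y' w : cells y w -> cells y' w -> y = y'.
Proof.
move=> h h'; apply/ffunP => k; apply/ffunP => i.
exact: cell_inj (h i I k I) (h' i I k I).
Qed.

Lemma prob_cells y : P (cells y) = (((#|'I_m.+1|%:R ^+ n) ^+ dim)^-1)%:E.
Proof.
have [_ ->] := iid; last by move=> i k; exact: measurable_itv.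
have M0 : 0 < M by rewrite ltr0n.
transitivity (\prod_(i < n) \prod_(k < dim) (M^-1)%:E)%E.
  apply: eq_bigr => i _; apply: eq_bigr => k _.
  rewrite (_ : cell _ `&` _ = cell (y k i)).
    rewrite /cell lebesgue_measure_itv /= lte_fin ifT; last first.
      by rewrite ltr_pM2r ?invr_gt0 // ltr_pM2l ?ltr0n // ltr_nat.
    rewrite -EFinB -EFinM; congr EFin; rewrite -natr1; field.
    by rewrite gt_eqF.
  apply/setIidPl => x; rewrite /cell /= !in_itv /= => /andP[x1 x2]; apply/andP; split.
    by apply: le_trans x1; rewrite divr_ge0 ?mulr_ge0 // ltW.
  apply: (lt_le_trans x2); rewrite ler_pdivrMr // ler_pM2l ?ltr0n // ler_nat.
  exact: ltn_ord.
rewrite card_ord -/M -!exprVn -exprM mulnC exprM.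
have h (c : R) k : (\prod_(i < k) c%:E = (c ^+ k)%:E)%E.
  elim: k => [|k IH]; first by rewrite big_ord0.
  by rewrite big_ord_recr /= IH -EFinM exprSr.
rewrite (eq_bigr (fun=> (M^-1 ^+ dim)%:E)) => [|i _]; exact: h.
Qed.

Definition good (y : conf) : bool :=
  [forall i, forall j, (i != j) ==> [forall k, y k i - y k j \notin bdset m c0]].

Lemma rgg_cells y w : good y -> cells y w -> rgg_graph X tau w = grid_graph (farset m c0) y.
Proof.
move=> gy wy; apply/finset.setP => e.
have circE i j k : i != j ->
    (circ_dist (X i k w) (X j k w) <= tau) = (y k i - y k j \notin farset m c0).
  move=> ij; apply: circ_dist_grid => //.
  - by have := wy i I k I; rewrite /cell /= in_itv.
  - by have := wy j I k I; rewrite /cell /= in_itv.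
  - by move/forallP/(_ i)/forallP/(_ j): gy; rewrite ij => /forallP.
have /finset.cards2P[a [b [ab E]]] := valP e.
apply/mem_rggP/idP => [h|].
  rewrite finset.in_set; apply/forallP => k.
  rewrite (farE (@farset_sym m c0) (farset0 m c0) _ E) -circE //.
  by apply: h; rewrite E !finset.inE eqxx ?orbT.
rewrite finset.in_set => /forallP h i j k; rewrite E.
have hk := h k; rewrite (farE (@farset_sym m c0) (farset0 m c0) _ E) in hk.
rewrite !finset.in_set2 => /orP[] /eqP -> /orP[] /eqP ->; rewrite ?circ_dist_self //.
  by rewrite circE.
by rewrite circE 1?eq_sym // -farset_sym opprB.
Qed.

(** Union bound over two vertices and a coordinate: a difference of two distinct points is uniform,
    and [bdset] has at most 7 elements. *)
Lemma mean_bad : mean (fun y : conf => (~~ good y)%:R : R) <= (n * n * dim * 7)%:R / M.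
Proof.
have M0 : 0 < M by rewrite ltr0n.
apply: (@le_trans _ _ (mean (fun y : conf => \sum_(i < n) \sum_(j < n | i != j) \sum_(k < dim)
    (y k i - y k j \in bdset m c0)%:R : R))).
  apply: ler_mean => y; rewrite /good.
  have nn i : 0 <= \sum_(j < n | i != j) \sum_(k < dim) (y k i - y k j \in bdset m c0)%:R :> R.
    by do 2!apply: sumr_ge0 => ? _.
  case: forallP => [_|/forallP/forallPn[i /forallPn[j]]]; first by apply: sumr_ge0.
  rewrite negb_imply => /andP[ij /forallPn[k]]; rewrite negbK => hk.
  rewrite (bigD1 i) //= -[X in X <= _]addr0 lerD ?sumr_ge0 //.
  rewrite (bigD1 j) //= -[X in X <= _]addr0 lerD //; last by do 2!apply: sumr_ge0 => ? _.
  rewrite (bigD1 k) //= hk -[X in X <= _]addr0 lerD // ?sumr_ge0 //.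
rewrite mean_sum; apply: (@le_trans _ _ (\sum_(i < n) (n * dim * 7)%:R / M)); last first.
  rewrite sumr_const card_ord -mulrnAl -mulrnA; apply: ler_wpM2r; first by rewrite invr_ge0 ltW.
  by rewrite ler_nat; apply: eq_leq; ring.
apply: ler_sum => i _; rewrite mean_sum.
apply: (@le_trans _ _ (\sum_(j < n | i != j) (dim * 7)%:R / M)); last first.
  rewrite sumr_const -mulrnAl -mulrnA; apply: ler_wpM2r; first by rewrite invr_ge0 ltW.
  rewrite ler_nat -[(n * dim * 7)%N]mulnA [(n * _)%N]mulnC; apply: leq_mul => //.
  by rewrite -[X in (_ <= X)%N]card_ord max_card.
apply: ler_sum => j ij; rewrite mean_sum.
apply: (@le_trans _ _ (\sum_(k < dim) 7 / M)); last first.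
  by rewrite sumr_const card_ord -mulrnAl -mulrnA mulnC.
apply: ler_sum => k _.
rewrite (mean_coord k (fun x : {ffun 'I_n -> 'I_m.+1} => (x i - x j \in bdset m c0)%:R : R)).
have := avg_leaf (phi := fun=> 1 : R) (fun c : 'I_m.+1 => (c \in bdset m c0)%:R : R)
  (a := i) (b := j) _ (fun _ _ => erefl).
rewrite eq_sym ij avg_cst mul1r => /(_ isT) h.
rewrite (eq_avg (psi := fun x : {ffun 'I_n -> 'I_m.+1} => 1 * (x i - x j \in bdset m c0)%:R : R)).
  rewrite h card_ord -/M mulrC; apply: ler_wpM2r; first by rewrite invr_ge0 ltW.
  rewrite -natr_sum ler_nat; apply: leq_trans (card_bdset m c0).
  by rewrite -sum1_card [X in (_ <= X)%N]big_mkcond /=; apply: leq_sum => c _; case: (_ \in _).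
by move=> x; rewrite mul1r.
Qed.

(** The good cells whose grid graph is [G] are disjoint, equally likely, and contained in the event
    that the geometric graph is [G]; the remaining cells cost at most [mean_bad]. *)
Lemma rgg_prob_ge (G : graph n) :
  grid_prob R (farset m c0) dim G - (n * n * dim * 7)%:R / M <= rgg_prob P X tau G.
Proof.
rewrite -lee_fin rgg_probE.
have mU Q : measurable (\bigcup_(y in [set` Q]) cells y).
  apply: fin_bigcup_measurable => [|y _]; [exact: finite_finset | exact: measurable_cells].
pose Q := [pred y | good y && (grid_graph (farset m c0) y == G)].
apply: (@le_trans _ _ (P (\bigcup_(y in [set` Q]) cells y))); last first.
  apply: le_measure; rewrite ?inE //; first exact: measurable_rgg.
  by move=> w [y /= /andP[gy /eqP yG] wy]; rewrite (rgg_cells gy wy).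
rewrite measure_finType_bigcup; [|exact: measurable_cells|exact: cells_inj].
under eq_bigr do rewrite prob_cells.
rewrite sumEFin lee_fin lerBlDr.
apply: (@le_trans _ _ (\sum_(y | Q y) ((#|'I_m.+1|%:R ^+ n) ^+ dim)^-1 + mean (fun y : conf => (~~ good y)%:R : R))); last first.
  by rewrite lerD2l; exact: mean_bad.
have -> : \sum_(y | Q y) ((#|'I_m.+1|%:R ^+ n) ^+ dim)^-1 =
    mean (fun y : conf => (Q y)%:R : R).
  rewrite /mean mulr_sumr big_mkcond; apply: eq_bigr => y _.
  by case: ifP; rewrite ?mulr1 ?mulr0.
rewrite /grid_prob -meanD; apply: ler_mean => y /=.
by case: (good y); case: (_ == G); rewrite /= ?addr0 ?add0r ?lexx ?ler01.
Qed.

End Grid.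

Definition gridfar (m : nat) : {set 'I_m.+1} := farset m (Num.truncn (tau * m.+1%:R / 2)).

(** Each grid probability exceeds its target by at most [K / m.+1]. Both laws have total mass 1, so
    summing this over all other graphs gives the opposite inequality with a factor [N]. *)
Lemma cvg_grid_prob (G : graph n) :
  grid_prob R (gridfar m) dim G @[m --> \oo] --> rgg_prob P X tau G.
Proof.
pose K : R := (n * n * dim * 7)%:R; pose N : R := #|{: graph n}|%:R.
have e0 m : 0 <= K / m.+1%:R by rewrite divr_ge0.
have lo m (G' : graph n) : grid_prob R (gridfar m) dim G' <= rgg_prob P X tau G' + K / m.+1%:R.
  by rewrite -lerBlDr; exact: rgg_prob_ge.
have sum1 m : \sum_(G' : graph n) grid_prob R (gridfar m) dim G' = 1.
  have := sum_grid_prob (gridfar m) dim (fun _ : {set edge n} => 1 : R).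
  by rewrite mean_cst => <-; apply: eq_bigr => G' _; rewrite mulr1.
have up m : rgg_prob P X tau G - N * (K / m.+1%:R) <= grid_prob R (gridfar m) dim G.
  have h1 : \sum_(G' | G' != G) grid_prob R (gridfar m) dim G' <=
      \sum_(G' | G' != G) rgg_prob P X tau G' + N * (K / m.+1%:R).
    apply: (le_trans (ler_sum _ (fun G' _ => lo m G'))).
    rewrite big_split lerD2l sumr_const -[X in X <= _]mulr_natl; apply: ler_wpM2r => //.
    by rewrite ler_nat max_card.
  have := sum_rgg_prob; rewrite (bigD1 G) //=; move: h1 => /[swap] E1.
  have := sum1 m; rewrite (bigD1 G) //= => E2 h1; move: E1 E2 h1.
  set A := \sum_(i | i != G) rgg_prob P X tau i; set B := \sum_(i | i != G) grid_prob _ _ _ i.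
  by move: (N * _) A B => c A B; lra.
apply: (@squeeze_cvgr _ _ _ _ (fun m => rgg_prob P X tau G - N * (K / m.+1%:R))
   (fun m => rgg_prob P X tau G + K / m.+1%:R)).
- by apply: nearW => m; rewrite up lo.
- rewrite -[X in _ --> X]subr0; apply: cvgB; first exact: cvg_cst.
  rewrite -(mulr0 N); apply: cvgMr; rewrite -(mulr0 K); apply: cvgMr.
  exact: cvg_harmonic.
- rewrite -[X in _ --> X]addr0; apply: cvgD; first exact: cvg_cst.
  rewrite -(mulr0 K); apply: cvgMr; exact: cvg_harmonic.
Qed.

Lemma circ_distC (x y : R) : circ_dist x y = circ_dist y x.
Proof.
have /andP[] := floor_itv ((x - y) / 2); set k := Num.floor _; rewrite intrD => h1 h2.
rewrite (@circ_distE _ _ _ k); last by apply/andP; split; lra.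
case: (eqVneq (x - y - 2 * k%:~R) 0) => [r0|rn0].
  have yx : y - x - 2 * (- k)%:~R = 0 by rewrite mulrNz; lra.
  by rewrite (@circ_distE _ y x (- k)) ?yx ?r0 // lexx ltr0n.
have r0 : 0 < x - y - 2 * k%:~R by rewrite lt_neqAle eq_sym rn0 /=; lra.
have yx : y - x - 2 * (- k - 1)%:~R = 2 - (x - y - 2 * k%:~R).
  by rewrite intrB mulrNz; lra.
rewrite (@circ_distE _ y x (- k - 1)) yx; last by apply/andP; split; lra.
by rewrite minC; congr Num.min; rewrite subKr.
Qed.

Variable p : R.
Hypothesis edge_prob : forall i j : 'I_n, i != j ->
  P [set w | linf_dist (X i ^~ w) (X j ^~ w) <= tau] = p%:E.

Lemma sum_rgg_prob_edge (e : edge n) : \sum_G rgg_prob P X tau G * (e \in G)%:R = p.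
Proof.
have /finset.cards2P[a [b [ab E]]] := valP e.
rewrite (eq_bigr (fun G : graph n => if e \in G then rgg_prob P X tau G else 0)); last first.
  by move=> G _; case: ifP; rewrite ?mulr1 ?mulr0.
rewrite -big_mkcond; apply: EFin_inj; rewrite sum_rgg_prob_pred -(edge_prob ab).
congr (P _); apply/seteqP; split => w /=.
  move=> /mem_rggP h; rewrite linf_dist_leE; apply/forallP => k.
  by apply: h; rewrite E finset.in_set2 eqxx ?orbT.
rewrite linf_dist_leE => /forallP h; apply/mem_rggP => i j k.
rewrite E !finset.in_set2 => /orP[] /eqP -> /orP[] /eqP ->; rewrite ?circ_dist_self //.
by rewrite circ_distC; exact: h.
Qed.

Lemma cvg_sum_grid_prob (phi : nat -> graph n -> R) (psi : graph n -> R) :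
  (forall G, phi m G @[m --> \oo] --> psi G) ->
  \sum_G grid_prob R (gridfar m) dim G * phi m G @[m --> \oo] -->
  \sum_G rgg_prob P X tau G * psi G.
Proof.
move=> h; apply: cvg_big => [|G _]; first exact: add_continuous.
apply: cvgM; [exact: cvg_grid_prob | exact: h].
Qed.

(** The probability of the edge [e] is a linear functional of the law of the graph, so it converges
    with that law. *)
Lemma cvg_grid_edge_prob (e : edge n) : grid_edge_prob R (gridfar m) dim @[m --> \oo] --> p.
Proof.
rewrite -(sum_rgg_prob_edge e).
have -> : (fun m => grid_edge_prob R (gridfar m) dim) =
    (fun m => \sum_(G : graph n) grid_prob R (gridfar m) dim G * (e \in G)%:R).
  apply/funext => m; rewrite sum_grid_prob_edge //; [exact: farset_sym | exact: farset0].
apply: cvg_sum_grid_prob => G; exact: cvg_cst.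
Qed.

Lemma cvg_chi (e : edge n) (H G : graph n) :
  chi (grid_edge_prob R (gridfar m) dim) H G @[m --> \oo] --> chi p H G.
Proof.
apply: cvg_big => [|e' _]; first exact: mul_continuous.
apply: cvgB; [exact: cvg_cst | exact: (cvg_grid_edge_prob e)].
Qed.

End Discretization.

(** * Fourier coefficients of the geometric graph *)

Section RggFourier.
Context (R : realType) (d0 : measure_display) (T : measurableType d0).
Context (P : probability T R) (n dim : nat) (X : 'I_n -> 'I_dim -> T -> R) (tau p : R).
Hypothesis iid : iid_unif_torus P X.
Hypothesis tau0 : 0 <= tau.
Hypothesis edge_prob : forall i j : 'I_n, i != j ->
  P [set w | linf_dist (X i ^~ w) (X j ^~ w) <= tau] = p%:E.

(** The bounds on [Psi] hold on every fine enough grid, and both sides converge as the grid is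
    refined. The parameter [L] is an upper bound for [ln (1/p)]. *)
Lemma rgg_fourier_le (H : graph n) (L b : R) (r : nat) :
  H != finset.set0 -> (0 < dim)%N -> 0 <= L -> expR (- L) < p -> 3 * L <= dim%:R -> 1 <= b ->
  (#|H| <= r * r)%N ->
  (2 * (r * r))%:R * (2 ^+ r * (Num.sqrt (2 * L / dim%:R) * b)) <= 2^-1 ->
  2 * L * (2 * ((2 * (r * r))%:R * (2 ^+ r * (Num.sqrt (2 * L / dim%:R) * b)))) <= 2^-1 ->
  b ^+ #|covered H| * `|\sum_G rgg_prob P X tau G * chi p H G| <= (leafless H)%:R * (2 * p ^+ #|H|).
Proof.
move=> /finset.set0Pn[e eH] dim0 L0 Lp L3 b1 Hr hz hd.
have dimR : 0 < dim%:R :> R by rewrite ltr0n.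
have b0 : 0 <= b by apply: le_trans b1.
have pcvg := cvg_grid_edge_prob iid tau0 edge_prob e.
have near_gep : \forall m \near \oo, expR (- L) < grid_edge_prob R (gridfar tau m) dim by exact: cvgr_gt pcvg _ Lp.
have fcvg := cvg_sum_grid_prob iid tau0 (fun G => cvg_chi iid tau0 edge_prob e (H := H) (G := G)).
have lcvg : b ^+ #|covered H| * `|\sum_G grid_prob R (gridfar tau m) dim G * chi (grid_edge_prob R (gridfar tau m) dim) H G|
    @[m --> \oo] --> b ^+ #|covered H| * `|\sum_G rgg_prob P X tau G * chi p H G|.
  by apply: cvgMr; apply: cvg_norm; exact: fcvg.
have rcvg : (leafless H)%:R * (2 * grid_edge_prob R (gridfar tau m) dim ^+ #|H|) @[m --> \oo] -->
    (leafless H)%:R * (2 * p ^+ #|H|).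
  apply: cvgMr; apply: cvgMr; elim: #|H| => [|k IH]; first exact: cvg_cst.
  by rewrite exprS; under eq_cvg do rewrite exprS; exact: cvgM.
apply: (ler_cvg_to lcvg rcvg).
near=> m.
have hgep : expR (- L) < grid_edge_prob R (gridfar tau m) dim by near: m.
set de := dens R (gridfar tau m).
have de0 : 0 <= de by exact: dens_ge0.
(* From [exp(-L) < (1 - de)^dim <= exp(-de * dim)]. *)
have deL : de * dim%:R <= L.
  have de1 : 0 <= 1 - de.
    rewrite subr_ge0 /de /dens ler_pdivrMr ?mul1r ?ler_nat ?max_card //; exact: cardZ_gt0.
  have : expR (- L) < expR (- (de * dim%:R)).
    apply: (lt_le_trans hgep).
    have -> : - (de * dim%:R) = dim%:R * - de by rewrite mulrN mulrC.
    rewrite /grid_edge_prob -/de expRM_natl.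
    by rewrite lerXn2r ?nnegrE ?expR_ge0 // expR_ge1Dx.
  by rewrite ltr_expR ltrN2 => /ltW.
have dele : de <= L / dim%:R by rewrite ler_pdivlMr.
(* This density bound serves twice: for the edge weights, and to make the far set free of zero-sum
   triples. *)
have de3 : de <= 3^-1.
  by apply: (le_trans dele); rewrite ler_pdivrMr //; lra.
rewrite (sum_grid_prob_fourier dim de3).
have gep0 : 0 <= grid_edge_prob R (gridfar tau m) dim by apply: le_trans (ltW hgep); exact: expR_ge0.
case: (boolP (leafless H)) => lH; last first.
  by rewrite (Psi_leaf dim (@farset_sym _ _) (farset0 _ _) de3 lH) mulr0 normr0 mulr0 mul0r.
rewrite mul1r normrM (ger0_norm (exprn_ge0 _ gep0)) mulrCA [2 * _]mulrC.
apply: ler_wpM2l; first exact: exprn_ge0.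
set s := Num.sqrt (2 * de).
have sle : s <= Num.sqrt (2 * L / dim%:R).
  rewrite ler_wsqrtr // -mulrA; apply: ler_wpM2l => //.
set z := (2 * (r * r))%:R * (2 ^+ r * (Num.sqrt (2 * L / dim%:R) * b)) in hz hd.
have zle : (2 * (r * r))%:R * (2 ^+ r * (s * b)) <= z.
  apply: ler_wpM2l => //; apply: ler_wpM2l; first exact: exprn_ge0.
  exact: ler_wpM2r.
have zs0 : 0 <= (2 * (r * r))%:R * (2 ^+ r * (s * b)).
  by rewrite !mulr_ge0 // ?exprn_ge0 // sqrtr_ge0.
apply: (@Psi_le R _ (gridfar tau m) n dim (@farset_sym _ _) (farset0 _ _) de3
  (farset_sumfree de3) H s b r) => //.
- exact: sqrtr_ge0.
- by rewrite sqr_sqrtr // mulr_ge0.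
- exact: le_trans hz.
- apply: le_trans hd; rewrite -/de.
  apply: (@le_trans _ _ (2 * (de * dim%:R) * (2 * z))).
    rewrite mulrA [dim%:R * _]mulrC -[2 * de * _]mulrA; apply: ler_wpM2l.
      by rewrite !mulr_ge0 // ltW.
    exact: ler_wpM2l.
  apply: ler_wpM2r; first by rewrite mulr_ge0 //; exact: le_trans zle.
  exact: ler_wpM2l.
Unshelve. all: by end_near. Qed.

End RggFourier.

(** * Low-degree polynomials and the Fourier mass they can see *)

Lemma all_le_bigmax (A : Type) (s : seq A) (F : A -> nat) :
  all (fun m => F m <= \max_(m <- s) F m)%N s.
Proof.
suff h k : (\max_(m <- s) F m <= k)%N -> all (fun m => F m <= k)%N s by exact: h.
by elim: s => //= m s IH; rewrite big_cons geq_max => /andP[-> /IH].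
Qed.

Section LowDegree.
Context (R : realType) (n : nat).

(** At 0/1 values a monomial depends only on its support [K m], whose size is at most the degree;
    [monomial_chi] then expands it in characters of subsets of [K m]. *)
Lemma eval_graph_span (p : R) (g : edgepoly R n) : exists c : graph n -> R,
  forall G, eval_graph g G = \sum_(H : graph n | (#|H| <= edgepoly_deg g)%N) c H * chi p H G.
Proof.
pose D := edgepoly_deg g.
pose K (m : mpoly.multinom (nedges n)) : graph n :=
  finset (fun e : edge n => mpoly.fun_of_multinom m (enum_rank e) != 0%N).
exists (fun H : graph n => \sum_(m <- mpoly.msupp g) mpoly.mcoeff m g *
   (if H \subset K m then p ^+ #|(K m :\: H)%SET| else 0)) => G.
under [RHS]eq_bigr do rewrite mulr_suml.
rewrite /eval_graph mpoly.mevalE exchange_big /=.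
have /all_filterP sE : all (fun m => mpoly.mdeg m <= D)%N (mpoly.msupp g) by exact: all_le_bigmax.
rewrite -sE !big_filter; apply: eq_bigr => m mD.
under [RHS]eq_bigr do rewrite -mulrA.
rewrite -mulr_sumr; congr (_ * _).
have Km : (#|K m| <= D)%N.
  apply: leq_trans mD.
  rewrite mpoly.mdegE -sum1_card (reindex (fun i : 'I_(nedges n) => enum_val i)) /=; last first.
    by apply: onW_bij; exact: enum_val_bij.
  rewrite big_mkcond /=; apply: leq_sum => i _; rewrite finset.in_set enum_valK.
  by case: ifP => //; rewrite lt0n.
transitivity (\prod_(e in K m) (e \in G)%:R : R).
  rewrite [RHS]big_mkcond /= (reindex (fun i : 'I_(nedges n) => enum_val i)) /=; last first.
    by apply: onW_bij; exact: enum_val_bij.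
  apply: eq_bigr => i _; rewrite finset.in_set enum_valK.
  case: eqP => [->|/eqP mi]; first by rewrite expr0.
  by case: (_ \in G); rewrite ?expr1n // expr0n (negbTE mi).
rewrite (monomial_chi p) [LHS]big_mkcond [RHS]big_mkcond /=; apply: eq_bigr => H _.
case: ifP => [HK|_]; last by rewrite mul0r if_same.
by rewrite ifT //; apply: leq_trans Km; exact: subset_leq_card.
Qed.

(** Only leafless [H] contribute, each at most [4 * t ^+ v] with [v] covered vertices:
    [p / (1 - p) <= 2 p <= 1] and [#|H| >= v]. Summing over vertex sets with the count of edge sets
    leaves a geometric-type sum. *)
Lemma fourier_mass_le (p b : R) (r D : nat) (w : graph n -> R) :
  0 < p -> p <= 2^-1 -> 0 < b -> (0 < r)%N -> (D <= r * r)%N ->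
  (forall H : graph n, H != finset.set0 -> (#|H| <= r * r)%N ->
     b ^+ #|covered H| * `|\sum_G w G * chi p H G| <= (leafless H)%:R * (2 * p ^+ #|H|)) ->
  n%:R * (((4 * r ^ 4).+1 ^ r)%N%:R * (2 * p / b ^+ 2)) <= 2^-1 ->
  \sum_(H : graph n | (#|H| <= D)%N && (H != finset.set0))
     (\sum_G w G * chi p H G) ^+ 2 / (p * (1 - p)) ^+ #|H| <=
  8 * (n%:R * (((4 * r ^ 4).+1 ^ r)%N%:R * (2 * p / b ^+ 2))).
Proof.
move=> p0 p2 b0 r0 Dr hw ht; set t := 2 * p / b ^+ 2; set Q := ((4 * r ^ 4).+1 ^ r)%N%:R.
have t0 : 0 <= t by rewrite divr_ge0 ?exprn_ge0 // ?mulr_ge0 // ltW.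
have q0 : 0 <= 1 - p by lra.
have pp0 : 0 <= 2 * p by lra.
have pp1 : 2 * p <= 1 by lra.
have pq : p <= 2 * p * (1 - p).
  have -> : 2 * p * (1 - p) = p + 2 * (p * (2^-1 - p)) by field.
  by rewrite lerDl mulr_ge0 // mulr_ge0 ?(ltW p0) // subr_ge0.
have sig0 : 0 < p * (1 - p) by rewrite mulr_gt0 //; lra.
apply: (@le_trans _ _ (\sum_(H : graph n | (#|H| <= r * r)%N && (H != finset.set0)) 4 * t ^+ #|covered H|)).
  rewrite big_mkcond [X in _ <= X]big_mkcond /=; apply: ler_sum => H _.
  case: (boolP ((#|H| <= D)%N && (H != finset.set0))) => [/andP[HD H0]|_]; last first.
    by case: ifP => // _; rewrite mulr_ge0 // exprn_ge0.
  have Hr := leq_trans HD Dr; rewrite Hr H0 /=.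
  have := hw _ H0 Hr; set S := \sum_G w G * chi p H G.
  rewrite ler_pdivrMr ?exprn_gt0 // -[S ^+ 2]ger0_norm ?sqr_ge0 // normrX.
  have B0 : 0 < b ^+ #|covered H| by rewrite exprn_gt0.
  case: (boolP (leafless H)) => lH; rewrite ?mul1r ?mul0r => hS; last first.
    have -> : `|S| = 0.
      by apply/eqP; rewrite eq_le normr_ge0 andbT -(ler_pM2l B0) mulr0.
    by rewrite expr0n /= !mulr_ge0 ?exprn_ge0 // ltW.
  have {}hS : `|S| <= 2 * p ^+ #|H| / b ^+ #|covered H| by rewrite ler_pdivlMr // mulrC.
  apply: (@le_trans _ _ ((2 * p ^+ #|H| / b ^+ #|covered H|) ^+ 2)).
    by rewrite lerXn2r ?nnegrE // (le_trans _ hS).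
  have -> : (2 * p ^+ #|H| / b ^+ #|covered H|) ^+ 2 =
      4 * (p ^+ #|H| / (b ^+ 2) ^+ #|covered H| * p ^+ #|H|).
    have sq (u v : R) : v != 0 -> (2 * u / v) ^+ 2 = 4 * (u / v ^+ 2 * u) by move=> ?; field.
    by rewrite [(b ^+ 2) ^+ _]exprAC sq // gt_eqF.
  (* One factor [p <= 2 p (1 - p)] per edge; then the power of [2 p <= 1] is lowered from the number
     of edges to the number of covered vertices. *)
  have hp : p ^+ #|H| <= (2 * p) ^+ #|covered H| * (1 - p) ^+ #|H|.
    apply: (@le_trans _ _ ((2 * p) ^+ #|H| * (1 - p) ^+ #|H|)).
      by rewrite -exprMn lerXn2r ?nnegrE ?(ltW p0) // (le_trans (ltW p0)).
    apply: ler_wpM2r; first exact: exprn_ge0.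
    by apply: ler_wiXn2l => //; exact: leafless_card.
  have -> : 4 * (p ^+ #|H| / (b ^+ 2) ^+ #|covered H| * p ^+ #|H|) =
      4 * p ^+ #|H| / (b ^+ 2) ^+ #|covered H| * p ^+ #|H| by rewrite !mulrA.
  have -> : 4 * t ^+ #|covered H| * (p * (1 - p)) ^+ #|H| =
      4 * p ^+ #|H| / (b ^+ 2) ^+ #|covered H| * ((2 * p) ^+ #|covered H| * (1 - p) ^+ #|H|).
    have ac (u v a q : R) : 4 * (a / v) * (u * q) = 4 * u / v * (a * q) by ring.
    by rewrite /t expr_div_n [(p * _) ^+ _]exprMn ac.
  apply: ler_wpM2l => //.
  by rewrite divr_ge0 ?mulr_ge0 ?exprn_ge0 // ltW.
rewrite -mulr_sumr; have -> : 8 = 4 * 2 :> R by rewrite -natrM.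
rewrite -mulrA; apply: ler_wpM2l => //.
apply: (le_trans (sum_small_graphs_le n t0 r0)).
rewrite (eq_bigr (fun J : {set 'I_n} => (Q * t) ^+ #|J|)); last by move=> J _; rewrite [RHS]exprMn.
have := @sum_nonempty_subset_pow R _ (finset.setTfor 'I_n) (Q * t).
rewrite finset.cardsT card_ord => /(_ _ ht); rewrite mulr_ge0 // => /(_ isT).
by apply: le_trans; rewrite le_eqVlt; apply/orP; left; apply/eqP; apply: eq_bigl => J; rewrite finset.subsetT.
Qed.

End LowDegree.

(** * The distinguishing bound under explicit numerical conditions *)

Section RggLowDegree.
Context (R : realType) (d0 : measure_display) (T : measurableType d0).
Context (P : probability T R) (n dim : nat) (X : 'I_n -> 'I_dim -> T -> R) (tau p : R).
Hypothesis iid : iid_unif_torus P X.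
Hypothesis tau0 : 0 <= tau.
Hypothesis edge_prob : forall i j : 'I_n, i != j ->
  P [set w | linf_dist (X i ^~ w) (X j ^~ w) <= tau] = p%:E.

(** The squared difference of means is at most the variance under [er_prob] times the Fourier mass,
    which is at most [eta ^+ 2]; adding the nonnegative second variance only enlarges the bound. *)
Lemma rgg_low_degree (g : edgepoly R n) (L b eta : R) (r : nat) :
  0 < p -> p <= 2^-1 -> 0 < eta -> (0 < r)%N -> (edgepoly_deg g <= r * r)%N ->
  (0 < dim)%N -> 0 <= L -> expR (- L) < p -> 3 * L <= dim%:R -> 1 <= b ->
  let z := (2 * (r * r))%:R * (2 ^+ r * (Num.sqrt (2 * L / dim%:R) * b)) in
  z <= 2^-1 -> 2 * L * (2 * z) <= 2^-1 ->
  let q := n%:R * (((4 * r ^ 4).+1 ^ r)%N%:R * (2 * p / b ^+ 2)) in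
  q <= 2^-1 -> 8 * q <= eta ^+ 2 ->
  `| gmean (rgg_prob P X tau) (eval_graph g) - gmean (er_prob p) (eval_graph g) |
  <= eta * Num.sqrt (gvar (er_prob p) (eval_graph g) + gvar (rgg_prob P X tau) (eval_graph g)).
Proof.
move=> p0 p2 eta0 r0 gr dim0 L0 Lp L3 b1 z hz hd q hq heta.
have b0 : 0 < b by apply: lt_le_trans b1.
have p1 : p < 1 by apply: le_lt_trans p2 _; rewrite invf_lt1 ?ltr1n.
have [c hc] := eval_graph_span p g.
have w1 := sum_rgg_prob iid tau0.
have low := low_degree_bound p0 p1 w1 hc.
have Vw : 0 <= gvar (rgg_prob P X tau) (eval_graph g).
  by apply: variance_ge0 w1 => G; exact: rgg_prob_ge0.
have mass := fourier_mass_le p0 p2 b0 r0 gr _ hq.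
have {}mass := le_trans (mass _ (fun H H0 Hr =>
   rgg_fourier_le iid tau0 edge_prob H0 dim0 L0 Lp L3 b1 Hr hz hd)) heta.
set V := gvar (er_prob p) (eval_graph g).
have V0 : 0 <= V.
  apply: variance_ge0 => [G|]; first by rewrite mulr_ge0 // exprn_ge0 //; [exact: ltW | rewrite subr_ge0 ltW].
  have := sum_ber_chi p (finset.set0 : graph n); rewrite eqxx => h; apply: etrans h; apply: eq_bigr => G _.
  by rewrite chi_set0 mulr1.
have -> Y : eta * Num.sqrt Y = Num.sqrt (eta ^+ 2 * Y).
  by rewrite sqrtrM ?sqr_ge0 // sqrtr_sqr gtr0_norm.
rewrite -sqrtr_sqr ler_wsqrtr //.
apply: (le_trans low); rewrite -/V mulrC.
apply: (@le_trans _ _ (eta ^+ 2 * V)); first exact: ler_wpM2r.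
by apply: ler_wpM2l; [exact: sqr_ge0 | rewrite lerDl].
Qed.

End RggLowDegree.

(** * Asymptotic inequalities between powers and exponentials *)

Section Numerics.
Variable R : realType.
Implicit Types x c eps eta : R.

Lemma expR_ge_pow x (k : nat) : 0 <= x -> (x / k.+1%:R) ^+ k.+1 <= expR x.
Proof.
move=> x0; have -> : expR x = expR (x / k.+1%:R) ^+ k.+1.
  by rewrite -expRM_natl mulrC divfK // pnatr_eq0.
rewrite lerXn2r ?nnegrE ?expR_ge0 ?divr_ge0 //.
by apply: le_trans (expR_ge1Dx _); rewrite lerDr.
Qed.

Lemma pow_le_expR (C : R) (k : nat) : exists X0 : R, forall x, X0 <= x -> C * x ^+ k <= expR x.
Proof.
exists (Num.max 0 (C * k.+1%:R ^+ k.+1)) => x; rewrite ge_max => /andP[x0 xC].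
apply: le_trans (expR_ge_pow k x0); rewrite expr_div_n ler_pdivlMr ?exprn_gt0 //.
by rewrite mulrAC [x ^+ k.+1]exprS; apply: ler_wpM2r => //; exact: exprn_ge0.
Qed.

(** Collects the largeness conditions on [x = (ln n)^(1/8)]: in order, they serve [r] and the
    exponents, the bound on [z], [b >= 1], [3 L <= dim], and the size of [q]. *)
Lemma numeric_threshold eps eta c : 0 < eps -> 0 < eta -> 0 < c ->
  exists X0 : R, forall x, X0 <= x ->
  [/\ 3 <= x, 288 * x ^+ 22 <= expR x, 2 * x ^+ 6 <= eps * x ^+ 8,
      6 * x ^+ 8 <= expR (eps * x ^+ 8) & 5 <= c * x /\ 16 * expR (- x) <= eta ^+ 2].
Proof.
move=> eps0 eta0 c0.
have [X1 h1] := pow_le_expR 288 22; have [X2 h2] := pow_le_expR (6 / eps) 1.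
exists (\big[Num.max/3]_(y <- [:: X1; X2 / eps; 2 / eps; 5 / c; 16 / eta ^+ 2]) y) => x.
rewrite !big_cons big_nil !ge_max => /and5P[x1 x2 x3 x4 /andP[x5 x6]].
have xpos : 0 < x by apply: lt_le_trans x6.
have x1' : 1 <= x by apply: le_trans x6; rewrite ler1n.
have xx8 : x <= x ^+ 8 by rewrite -[X in X <= _]expr1 ler_weXn2l.
split => //; first exact: h1.
- have -> : eps * x ^+ 8 = eps * x ^+ 2 * x ^+ 6 by rewrite -mulrA -exprD.
  apply: ler_wpM2r; first by rewrite exprn_ge0 // ltW.
  move: x3; rewrite ler_pdivrMr // mulrC => /le_trans; apply; apply: ler_wpM2l; first exact: ltW.
  by rewrite -[X in X <= _]expr1 ler_weXn2l.
- have := h2 (eps * x ^+ 8); rewrite expr1 => h.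
  have -> : 6 * x ^+ 8 = 6 / eps * (eps * x ^+ 8) by rewrite -mulrA mulKf // gt_eqF.
  apply: h; move: x2; rewrite ler_pdivrMr // mulrC => /le_trans; apply.
  by apply: ler_wpM2l => //; exact: ltW.
- split; first by move: x4; rewrite ler_pdivrMr // mulrC.
  rewrite expRN ler_pdivrMr ?expR_gt0 // mulrC -ler_pdivrMr ?exprn_gt0 //.
  by apply: (le_trans x5); apply: le_trans (expR_ge1Dx _); rewrite lerDr.
Qed.

End Numerics.

Section NumericConditions.
Variable R : realType.

(* [x] plays the role of (ln n)^(1/8), and [ey] that of the excess factor of [dim] over [n p]. *)
Lemma numeric_conditions (x eps eta c np ey dim : R) (r : nat) :
  3 <= x -> 288 * x ^+ 22 <= expR x -> 2 * x ^+ 6 <= eps * x ^+ 8 ->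
  6 * x ^+ 8 <= expR (eps * x ^+ 8) -> 5 <= c * x -> 16 * expR (- x) <= eta ^+ 2 ->
  expR (eps * x ^+ 8) <= np -> expR (c * x ^+ 7) <= ey -> np * ey <= dim ->
  (0 < r)%N -> r%:R <= x ^+ 5 + 1 ->
  let L := 2 * x ^+ 8 in let b := Num.sqrt dim / expR (x ^+ 6) in
  let z := (2 * (r * r))%:R * (2 ^+ r * (Num.sqrt (2 * L / dim) * b)) in
  let q := ((4 * r ^ 4).+1 ^ r)%N%:R * (2 * np / b ^+ 2) in
  [/\ 3 * L <= dim, 1 <= b, z <= 2^-1, 2 * L * (2 * z) <= 2^-1 & q <= 2^-1 /\ 8 * q <= eta ^+ 2].
Proof.
move=> x3 h1 h2 h3 h4 h5 hnp hey hdim r0 rx L b z q.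
have x0 : 0 < x by lra.
have xn0 k : 0 < x ^+ k by rewrite exprn_gt0.
have np0 : 0 < np by apply: lt_le_trans hnp; exact: expR_gt0.
have xpow j k : (j <= k)%N -> x ^+ j <= x ^+ k by move=> jk; rewrite ler_weXn2l //; lra.
have ey1 : 1 <= ey.
  apply: le_trans hey; rewrite -expR0 ler_expR mulr_ge0 ?(ltW (xn0 _)) //.
  by rewrite -(pmulr_lge0 _ x0); lra.
have npdim : np <= dim by apply: le_trans hdim; rewrite ler_peMr // ltW.
have dim0 : 0 < dim by exact: lt_le_trans npdim.
have edim := le_trans hnp npdim.
have L3 : 3 * L <= dim by apply: le_trans edim; apply: le_trans h3; rewrite /L; lra.
set be := expR (x ^+ 6).
have be0 : 0 < be by exact: expR_gt0.
have be2 : be ^+ 2 = expR (2 * x ^+ 6) by rewrite expRM_natl.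
have b1 : 1 <= b.
  rewrite /b -/be ler_pdivlMr // mul1r -(gtr0_norm be0) -sqrtr_sqr ler_wsqrtr // be2.
  by apply: le_trans edim; rewrite ler_expR.
have b2 : b ^+ 2 = dim / be ^+ 2 by rewrite expr_div_n sqr_sqrtr // ltW.
(* The square root of [dim] in [b] cancels the one in the denominator, so only [1 / be] is left to
   make [z] small. *)
have zE : z = (2 * (r * r))%:R * (2 ^+ r * (2 * x ^+ 4)) / be.
  suff E : Num.sqrt (2 * L / dim) * b = 2 * x ^+ 4 / be by rewrite /z E !mulrA.
  have -> : 2 * L / dim = (2 * x ^+ 4) ^+ 2 / dim by rewrite /L exprMn -exprM; field; rewrite gt_eqF.
  rewrite sqrtrM ?sqr_ge0 // sqrtr_sqr gtr0_norm ?mulr_gt0 // sqrtrV ?(ltW dim0) //.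
  by rewrite /b mulrA mulfVK // gt_eqF // sqrtr_gt0.
have r2 : r%:R <= 2 * x ^+ 5.
  by apply: (le_trans rx); have := xpow 0%N 5%N isT; rewrite expr0; lra.
have er : 2 ^+ r <= expR (x ^+ 5 + 1).
  apply: (@le_trans _ _ (expR r%:R)); last by rewrite ler_expR.
  rewrite -[r%:R]mulr1 expRM_natl lerXn2r ?nnegrE ?expR_ge0 //.
  exact: (expR_ge1Dx 1).
have ebe : expR (x ^+ 5 + 1) * expR x <= be.
  rewrite -expRD ler_expR; have -> : x ^+ 6 = x * x ^+ 5 by rewrite -exprS.
  have h := xpow 1%N 5%N isT; have h' : 3 * x ^+ 5 <= x * x ^+ 5 by rewrite ler_pM2r.
  by rewrite expr1 in h; lra.
have z0 : 0 <= z by rewrite zE !mulr_ge0 // ?exprn_ge0 // ?invr_ge0 ltW.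
(* Since [2 * L * (2 * z) = 8 * x ^+ 8 * z], this single bound yields both smallness conditions on
   [z]. *)
have zmain : (8 * x ^+ 8 + 1) * z <= 2^-1.
  rewrite zE mulrA ler_pdivrMr //.
  apply: (@le_trans _ _ (2^-1 * (expR (x ^+ 5 + 1) * expR x))); last by rewrite ler_pM2l ?invr_gt0.
  rewrite [expR _ * _]mulrC [X in _ <= X]mulrA.
  have -> : (8 * x ^+ 8 + 1) * ((2 * (r * r))%:R * (2 ^+ r * (2 * x ^+ 4))) =
     ((8 * x ^+ 8 + 1) * (2 * (r%:R * r%:R)) * (2 * x ^+ 4)) * 2 ^+ r by rewrite !natrM; ring.
  apply: ler_pM => //; rewrite ?exprn_ge0 //.
    by rewrite !mulr_ge0 ?addr_ge0 ?mulr_ge0 // ltW.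
  have k1 : 8 * x ^+ 8 + 1 <= 9 * x ^+ 8 by have := xpow 0%N 8%N isT; rewrite expr0; lra.
  have k2 : r%:R * r%:R <= (2 * x ^+ 5) * (2 * x ^+ 5) by apply: ler_pM.
  apply: (@le_trans _ _ ((9 * x ^+ 8) * (2 * ((2 * x ^+ 5) * (2 * x ^+ 5))) * (2 * x ^+ 4))).
    apply: ler_wpM2r; first by rewrite mulr_ge0 // ltW.
    apply: ler_pM => //; last exact: ler_wpM2l.
    by rewrite addr_ge0 // mulr_ge0 // ltW.
  have -> : 9 * x ^+ 8 * (2 * (2 * x ^+ 5 * (2 * x ^+ 5))) * (2 * x ^+ 4) = 2^-1 * (288 * x ^+ 22).
    have -> : x ^+ 22 = x ^+ 8 * (x ^+ 5 * x ^+ 5) * x ^+ 4 by rewrite -!exprD.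
    by field.
  by rewrite ler_pM2l ?invr_gt0.
have zz : 0 <= 8 * x ^+ 8 * z by rewrite !mulr_ge0 // ltW.
(* The count of edge sets and [be ^+ 2] cost [exp(2 x^6)] each, while the excess of [dim] gains
   [exp(c x^7) >= exp(5 x^6)]; at least [exp(-x^6) <= exp(-x)] remains as a gain. *)
have qmain : 8 * q <= 16 * expR (- x).
  rewrite /q b2.
  have npd : np / dim <= expR (- (c * x ^+ 7)).
    rewrite expRN ler_pdivrMr // ler_pdivlMl ?expR_gt0 //.
    apply: le_trans hdim; rewrite mulrC; apply: ler_wpM2l => //; exact: ltW.
  have Qle : ((4 * r ^ 4).+1 ^ r)%N%:R <= expR (2 * x ^+ 6).
    rewrite natrX; apply: (@le_trans _ _ (expR x ^+ r)).
      rewrite lerXn2r ?nnegrE ?expR_ge0 // -natr1 natrM natrX.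
      apply: le_trans h1.
      have h : r%:R ^+ 4 <= 16 * x ^+ 20.
        have -> : 16 * x ^+ 20 = (2 * x ^+ 5) ^+ 4 by rewrite exprMn -exprM -natrX.
        by rewrite lerXn2r ?nnegrE // (le_trans _ r2).
      move: h (xpow 20%N 22%N isT) (xpow 0%N 22%N isT); rewrite expr0.
      by move: (x ^+ 20) (x ^+ 22) (r%:R ^+ 4) => u v w; clear; lra.
    rewrite -expRM_natl ler_expR; have -> : 2 * x ^+ 6 = 2 * x ^+ 5 * x by rewrite -mulrA -exprSr.
    by rewrite ler_pM2r.
  have -> : 8 * (((4 * r ^ 4).+1 ^ r)%N%:R * (2 * np / (dim / be ^+ 2))) =
      16 * (((4 * r ^ 4).+1 ^ r)%N%:R * (be ^+ 2 * (np / dim))).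
    by move: ((4 * r ^ 4).+1 ^ r)%N%:R => Q; field; rewrite !gt_eqF.
  apply: ler_wpM2l => //.
  apply: (@le_trans _ _ (expR (2 * x ^+ 6) * (expR (2 * x ^+ 6) * expR (- (c * x ^+ 7))))).
    rewrite be2; apply: ler_pM => //; first by rewrite mulr_ge0 ?expR_ge0 // divr_ge0 // ltW.
    by apply: ler_wpM2l; first exact: expR_ge0.
  rewrite -!expRD ler_expR.
  have -> : c * x ^+ 7 = c * x * x ^+ 6 by rewrite -mulrA -exprS.
  have : 5 * x ^+ 6 <= c * x * x ^+ 6 by rewrite ler_pM2r.
  by have := xpow 1%N 6%N isT; rewrite expr1; lra.
have e4 : 4 * expR (- x) <= 1.
  rewrite expRN ler_pdivrMr ?expR_gt0 // mul1r; apply: le_trans (expR_ge1Dx _); lra.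
have L' : 2 * L * (2 * z) = 8 * x ^+ 8 * z by rewrite /L; ring.
have zz' : (8 * x ^+ 8 + 1) * z = 8 * x ^+ 8 * z + z by rewrite mulrDl mul1r.
split => //; rewrite ?L'.
- by move: zmain; rewrite zz'; lra.
- by move: zmain; rewrite zz'; lra.
- by split; [lra | exact: le_trans h5].
Qed.

End NumericConditions.

(** * Eighth roots, and the decay of the exponent function *)

Section Powers.
Variable R : realType.
Implicit Types a x : R.

Lemma root8K a : 0 <= a -> (a `^ 8^-1) ^+ 8 = a.
Proof. by move=> a0; rewrite -powR_mulrn ?powR_ge0 // -powRrM mulVf // powRr1. Qed.

Lemma exprn8K x : 0 <= x -> (x ^+ 8) `^ 8^-1 = x.
Proof. by move=> x0; rewrite -powR_mulrn // -powRrM mulfV // powRr1. Qed.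

Lemma ln_root8_cvg0 : ((ln t) `^ (- 8^-1) @[t --> +oo] --> (0 : R)).
Proof.
apply/cvgrPdist_le => e e0; near=> t.
have ht : (e^-1) ^+ 8 <= ln t.
  rewrite -ler_expR lnK; first by near: t; exact: nbhs_pinfty_ge (num_real _).
  by rewrite posrE; near: t; exact: nbhs_pinfty_gt (num_real _).
rewrite sub0r normrN ger0_norm ?powR_ge0 // powRN.
rewrite -[e]invrK lef_pV2 ?posrE ?invr_gt0 //; last first.
  by apply: powR_gt0; apply: lt_le_trans ht; rewrite exprn_gt0 // invr_gt0.
rewrite -[X in X <= _]exprn8K ?invr_ge0 ?(ltW e0) //.
by apply: ge0_ler_powR; rewrite ?nnegrE ?invr_ge0 // ?(le_trans _ ht) // exprn_ge0 // invr_ge0 ltW.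
Unshelve. all: by end_near. Qed.

End Powers.

(** * Choice of the exponent function and of all parameters *)

Theorem theorem1p4 (R : realType) (eps : R) :
  0 < eps ->
  exists f : R -> R,
    (f x @[x --> +oo] --> 0) /\
    forall delta : R, 0 < delta ->
    forall eta : R, 0 < eta ->
    exists N : nat, forall n : nat, (N <= n)%N ->
    forall (p : R) (dim : nat),
      n%:R `^ (-1 + eps) <= p -> p <= 2^-1 ->
      n%:R `^ delta <= dim%:R ->
      (n%:R * p) `^ (1 + f (n%:R * p)) <= dim%:R ->
    forall (d0 : measure_display) (T : measurableType d0) (P : probability T R)
           (X : 'I_n -> 'I_dim -> T -> R) (tau : R),
      iid_unif_torus P X ->
      (forall i j : 'I_n, i != j ->
         P [set w | linf_dist (X i ^~ w) (X j ^~ w) <= tau] = p%:E) ->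
    forall g : edgepoly R n,
      (edgepoly_deg g)%:R <= ln (n%:R : R) `^ (5 / 4) / ln (ln (n%:R : R)) ->
      `| gmean (rgg_prob P X tau) (eval_graph g) - gmean (er_prob p) (eval_graph g) |
      <= eta * Num.sqrt (gvar (er_prob p) (eval_graph g)
                         + gvar (rgg_prob P X tau) (eval_graph g)).
Proof.
(* With this choice [t^(f t) = exp((ln t)^(7/8))], which outgrows the losses of order
   [exp((ln n)^(3/4))] for [t = n p >= n^eps]. *)
move=> eps0; exists (fun t => (ln t) `^ (- 8^-1)); split; first exact: ln_root8_cvg0.
move=> delta _ eta eta0.
(* Chosen so that [ln (n p) >= eps * ln n] becomes [y ^+ 7 >= c * x ^+ 7] for the eighth roots [y]
   and [x]. *)
pose c := (eps `^ 8^-1) ^+ 7; have c0 : 0 < c by rewrite exprn_gt0 // powR_gt0.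
have [X0 hX] := numeric_threshold eps0 eta0 c0.
(* [ln n >= e] makes [ln (ln n) >= 1], and the second term gives [x >= X0]; the inner maximum with
   [0] keeps eighth powers monotone. *)
pose B := Num.max (expR 1) (Num.max 0 X0 ^+ 8).
(* One successor exceeds [expR B]; with two, [n >= 2], so that some edge exists. *)
exists (Num.truncn (expR B)).+2 => n Nn p dim pge ple _ dimge d0 T P X tau iid edge_prob g hg.
have nB : expR B <= n%:R.
  apply: (@le_trans _ _ (Num.truncn (expR B)).+1%:R); last by rewrite ler_nat; exact: ltnW.
  by rewrite ltW //; have /andP[] := truncn_itv (expR_ge0 B).
have n0 : 0 < n%:R :> R by apply: lt_le_trans nB; exact: expR_gt0.
pose l : R := ln n%:R.
have lB : B <= l by rewrite -ler_expR lnK.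
have le1 : expR 1 <= l by apply: le_trans lB; rewrite le_max lexx.
have l0 : 0 < l by apply: lt_le_trans le1; exact: expR_gt0.
pose x := l `^ 8^-1.
have x8 : x ^+ 8 = l by rewrite root8K // ltW.
have xX : X0 <= x.
  have m0 : 0 <= Num.max 0 X0 by rewrite le_max lexx.
  apply: (@le_trans _ _ (Num.max 0 X0)); first by rewrite le_max lexx orbT.
  rewrite -[X in X <= _]exprn8K //; apply: ge0_ler_powR; rewrite ?nnegrE ?exprn_ge0 ?(ltW l0) ?invr_ge0 //.
  by apply: le_trans lB; rewrite le_max lexx orbT.
have [x3 h1 h2 h3 [h4 h5]] := hX _ xX.
have x0 : 0 <= x by exact: powR_ge0.
have npow a : n%:R `^ a = expR (a * l) by rewrite /powR gt_eqF.
have p0 : 0 < p by apply: lt_le_trans pge; rewrite npow expR_gt0.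
have np0 : 0 < n%:R * p by rewrite mulr_gt0.
have npge : expR (eps * x ^+ 8) <= n%:R * p.
  apply: (@le_trans _ _ (n%:R * n%:R `^ (-1 + eps))); last by rewrite ler_pM2l.
  by rewrite npow -{1}(lnK (n0 : n%:R \is Num.pos)) -expRD ler_expR -/l x8; lra.
pose La := ln (n%:R * p).
have Lage : eps * l <= La by rewrite -ler_expR lnK // -x8.
have La0 : 0 < La by apply: lt_le_trans Lage; rewrite mulr_gt0.
pose y := La `^ 8^-1.
have y0 : 0 < y by exact: powR_gt0.
have y8 : y ^+ 8 = La by rewrite root8K // ltW.
have hey : expR (c * x ^+ 7) <= expR (y ^+ 7).
  rewrite ler_expR /c -exprMn lerXn2r ?nnegrE ?mulr_ge0 ?powR_ge0 //.
  rewrite -powRM ?(ltW eps0) ?(ltW l0) //.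
  by apply: ge0_ler_powR; rewrite ?nnegrE ?invr_ge0 ?(ltW La0) // mulr_ge0 // ltW.
have hdim : n%:R * p * expR (y ^+ 7) <= dim%:R.
  apply: le_trans dimge; rewrite -/La powRN -/y /powR gt_eqF // -/La.
  rewrite mulrDl mul1r expRD lnK // ler_pM2l // ler_expR -y8 exprS mulKf //.
  by rewrite gt_eqF.
(* The target is [x ^+ 10 = (ln n)^(5/4) <= r * r], so [r] is about the square root of the degree
   bound. *)
pose r := (Num.truncn (x ^+ 5)).+1.
have /andP[r1 r2] := truncn_itv (exprn_ge0 5 x0).
have rx : r%:R <= x ^+ 5 + 1 by rewrite /r -natr1 lerD2r.
have [L3 b1 hz hd [hq heta]] := numeric_conditions x3 h1 h2 h3 h4 h5 npge hey hdim (ltn0Sn _) rx.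
have dim0 : (0 < dim)%N.
  by rewrite -(ltr_nat R); apply: lt_le_trans hdim; rewrite mulr_gt0 // expR_gt0.
have n2 : (1 < n)%N by apply: leq_trans Nn.
(* [linf_dist] is a maximum starting from [0]; a negative [tau] would make the edge event empty,
   contradicting [p > 0]. *)
have tau0 : 0 <= tau.
  rewrite leNgt; apply/negP => tauN.
  have := edge_prob (Ordinal (ltnW n2)) (Ordinal n2) isT.
  rewrite (_ : [set _ | _] = set0).
    by rewrite measure0 => -[] pE; move: p0; rewrite -pE ltxx.
  apply/seteqP; split => w //=; rewrite leNgt (lt_le_trans tauN) //.
  exact: bigmax_ge_id.
have qE : n%:R * (((4 * r ^ 4).+1 ^ r)%N%:R * (2 * p / (Num.sqrt dim%:R / expR (x ^+ 6)) ^+ 2)) =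
  ((4 * r ^ 4).+1 ^ r)%N%:R * (2 * (n%:R * p) / (Num.sqrt dim%:R / expR (x ^+ 6)) ^+ 2).
  by move: (((4 * r ^ 4).+1 ^ r)%N%:R) (_ ^+ 2) => Q b2; ring.
apply: (rgg_low_degree (L := 2 * x ^+ 8) (b := Num.sqrt dim%:R / expR (x ^+ 6)) (r := r)
   iid tau0 edge_prob) => //; rewrite ?qE //.
- rewrite -(ler_nat R); apply: (le_trans hg); apply: (@le_trans _ _ (l `^ (5 / 4))).
    rewrite ler_pdivrMr; last by rewrite ln_gt0 // (lt_le_trans _ le1) // -expR0 ltr_expR.
    rewrite ler_peMr ?powR_ge0 // -/l -ler_expR lnK //.
  have -> : l `^ (5 / 4) = x ^+ 5 * x ^+ 5.
    rewrite -exprD -powR_mulrn // -powRrM; congr (_ `^ _).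
    by rewrite /=; field.
  by rewrite natrM; apply: ler_pM; rewrite ?exprn_ge0 // ltW.
- by rewrite mulr_ge0 // exprn_ge0.
(* [L = 2 ln n] is admissible because [n^(-2) < n^(-1 + eps) <= p]. *)
- apply: lt_le_trans pge; rewrite npow ltr_expR x8.
  rewrite -subr_gt0 (_ : _ - _ = eps * l + l); last by ring.
  by rewrite addr_gt0 // mulr_gt0.
Qed.
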